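(* Let $\mathcal C$ be a triangulated category with countable coproducts, $w$ an $\aleph_1$-smashing weight structure on $\mathcal C$, and $\alpha$ an infinite regular cardinal. Then the following statements are valid. (1) The embedding $\mathcal C_{a-}\to\mathcal C$ possesses an exact right adjoint $R_{<\infty}$ whose kernel is the subcategory $\mathcal C_{+\infty}$, whereas the embedding $\mathcal C_{+\infty}\to\mathcal C$ possesses an exact left adjoint $L_{+\infty}$. Moreover, for any $M\in\mathrm{Obj}\,\mathcal C$ there exists a distinguished triangle $R_{<\infty}(M)\to M\to L_{+\infty}(M)\to R_{<\infty}(M)[1]$, and it is essentially the unique distinguished triangle $LM\to M\to RM\to LM[1]$ such that $LM\in\mathrm{Obj}\,\mathcal C_{a-}$ and $RM\in\mathrm{Obj}\,\mathcal C_{+\infty}$. (2) For any $M\in\mathrm{Obj}\,\mathcal C$ the object $R_{<\infty}(M)$ is $\mathcal C$-isomorphic to $\mathrm{hocolim}_{i\ge 0}\, w_{\le i}M$; here one takes arbitrary choices of $w_{\le i}M$ for all $i\ge 0$ and connects these objects by the unique morphisms $w_{\le i}M\to w_{\le i+1}M$ compatible with the weight decomposition morphisms $w_{\le j}M\to M$. (3) $\mathrm{Obj}\,\mathcal C_{a-}={}^{\perp}\mathrm{Obj}\,\mathcal C_{+\infty}$; hence $\mathrm{Obj}\,\mathcal C_{a-}$ is $\alpha$-smashing whenever $\mathcal C$ is. (4) For the restriction $w_{a-}$ of $w$ to $\mathcal C_{a-}$ (the weight structure $w$ does restrict to $\mathcal C_{a-}$) we have $(\mathcal C_{a-})_{w_{a-}\le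 0}=\mathcal C_{w\le 0}$, whereas $\mathcal C_{w\ge 0}$ consists precisely of extensions of objects of $\mathcal C_{+\infty}$ by elements of $(\mathcal C_{a-})_{w_{a-}\ge 0}$ (i.e., of those $M$ for which there is a distinguished triangle $A\to M\to C\to A[1]$ with $A\in(\mathcal C_{a-})_{w_{a-}\ge 0}$ and $C\in\mathrm{Obj}\,\mathcal C_{+\infty}$). Moreover, the functor $R_{<\infty}$ is weight-exact (with respect to $w$ and $w_{a-}$). (5) $(\mathcal C_{a-})_{w_{a-}\ge 0}$ coincides with the class of all $\mathrm{hocolim}\,Y_i$ with $Y_i\in\mathrm{Obj}\,\mathcal C_-\cap\mathcal C_{w\ge 0}$. (6) Assume that the class $\mathrm{Obj}\,\mathcal C_{+\infty}$ is $\alpha$-smashing in $\mathcal C$ (in particular, this is the case if $w$ is $\alpha$-smashing). Then $R_{<\infty}$ respects coproducts of less than $\alpha$ objects.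
   Context: A weight structure $w$ on a triangulated category $\mathcal C$ is a pair of classes $\mathcal C_{w\le 0},\mathcal C_{w\ge 0}\subset\mathrm{Obj}\,\mathcal C$ such that: (i) both are closed under $\mathcal C$-retracts; (ii) $\mathcal C_{w\le 0}\subset\mathcal C_{w\le 0}[1]$ and $\mathcal C_{w\ge 0}[1]\subset \mathcal C_{w\ge 0}$; (iii) $\mathcal C(X,Y)=0$ for all $X\in\mathcal C_{w\le 0}$, $Y\in\mathcal C_{w\ge 0}[1]$; (iv) every $M\in\mathrm{Obj}\,\mathcal C$ fits into a distinguished triangle $LM\to M\to RM\to LM[1]$ with $LM\in\mathcal C_{w\le 0}$, $RM\in\mathcal C_{w\ge 0}[1]$. $\mathcal C_{w\ge i}=\mathcal C_{w\ge 0}[i]$, $\mathcal C_{w\le i}=\mathcal C_{w\le 0}[i]$. For $m\in\mathbb Z$, an $m$-weight decomposition of $M$ is a distinguished triangle $w_{\le m}M\to M\to w_{\ge m+1}M\to (w_{\le m}M)[1]$ with $w_{\le m}M\in\mathcal C_{w\le m}$, $w_{\ge m+1}M\in\mathcal C_{w\ge m+1}$; it exists but is not canonical, and $w_{\le m}M$ denotes any choice. For any choices of $w_{\le i}M$ there are unique morphisms $w_{\le i-1}M\to w_{\le i}M$ compatible with the maps to $M$. For an infinite regular cardinal $\alpha$, a category (resp. class of objects in it) is $\alpha$-smashing if it has (resp. is closed under) coproducts of fewer than $\alpha$ objects; $w$ is $\alpha$-smashing if $\mathcal C$ and $\mathcal C_{w\ge 0}$ are. A class of objects is extension-closed if it contains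 $0$ and contains $C$ whenever there is a distinguished triangle $A\to C\to B\to A[1]$ with $A,B$ in it. $\langle\mathcal P\rangle^{\aleph_1}$ is the full triangulated subcategory whose object class is the smallest extension-closed $\aleph_1$-smashing class containing $\bigcup_{i\in\mathbb Z}\mathcal P[i]$. $\mathcal C_-$ is the full subcategory with object class $\bigcup_{i}\mathcal C_{w\le i}$; $\mathcal C_{a-}=\langle\mathrm{Obj}\,\mathcal C_-\rangle^{\aleph_1}$; $\mathcal C_{+\infty}$ is the full subcategory of left $w$-degenerate objects, i.e., with object class $\bigcap_{l}\mathcal C_{w\ge l}$. $w$ restricts to a full triangulated subcategory $\mathcal D$ if $(\mathcal C_{w\le 0}\cap\mathrm{Obj}\,\mathcal D,\mathcal C_{w\ge 0}\cap\mathrm{Obj}\,\mathcal D)$ is a weight structure on $\mathcal D$. ${}^\perp X=\{M:\mathcal C(M,N)=0\ \forall N\in X\}$. An exact functor between categories with weight structures is weight-exact if it maps each of the two classes $(\,\cdot\,)_{\le 0}$, $(\,\cdot\,)_{\ge 0}$ into the corresponding class of the target. For a sequence $\phi_i:Y_i\to Y_{i+1}$, $i\ge 0$, in $\mathcal C$, $\mathrm{hocolim}\,Y_i$ denotes a cone of the morphism $\coprod Y_i\to\coprod Y_i$ whose restriction to $Y_i$ is $\mathrm{id}_{Y_i}-\phi_i$ (defined up to non-canonical isomorphism). *)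

(* Defs.v *)
From mathcomp Require Import all_boot ssralg ssrint.
From mathcomp Require Import boolp classical_sets functions cardinality.

Set Implicit Arguments.
Unset Strict Implicit.
Unset Printing Implicit Defensive.

Import GRing.Theory.
Local Open Scope ring_scope.

Reserved Notation "g \oc f" (at level 40, left associativity).

(* The choice structure carried by the [zmodType]s is no restriction, as every
   type has one under the classical axioms of [boolp]. *)
Record preadditive := Preadditive {
  obj :> Type;
  hom : obj -> obj -> zmodType;
  idm : forall X, hom X X;
  comp : forall X Y Z, hom Y Z -> hom X Y -> hom X Z;
  comp1m : forall X Y (f : hom X Y), comp (idm Y) f = f;
  compm1 : forall X Y (f : hom X Y), comp f (idm X) = f;
  compA : forall X Y Z T (h : hom Z T) (g : hom Y Z) (f : hom X Y),
    comp h (comp g f) = comp (comp h g) f;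
  compDl : forall X Y Z (g g' : hom Y Z) (f : hom X Y),
    comp (g + g') f = comp g f + comp g' f;
  compDr : forall X Y Z (g : hom Y Z) (f f' : hom X Y),
    comp g (f + f') = comp g f + comp g f'
}.

Arguments hom {p} X Y.
Arguments idm {p} X.
Arguments comp {p X Y Z} g f.
Notation "g \oc f" := (comp g f) : ring_scope.

Section CategoryNotions.
Variable C : preadditive.

Definition is_iso (X Y : C) (f : hom X Y) : Prop :=
  exists g : hom Y X, g \oc f = idm X /\ f \oc g = idm Y.

Definition isomorphic (X Y : C) : Prop := exists f : hom X Y, is_iso f.

Definition is_zero (Z : C) : Prop :=
  forall X : C, (forall f : hom X Z, f = 0) /\ (forall f : hom Z X, f = 0).

Definition retract_of (X Y : C) : Prop :=
  exists (i : hom X Y) (r : hom Y X), r \oc i = idm X.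

Definition retract_closed (P : C -> Prop) : Prop :=
  forall X Y : C, retract_of X Y -> P Y -> P X.

Definition left_orth (P : C -> Prop) (M : C) : Prop :=
  forall N : C, P N -> forall f : hom M N, f = 0.

Definition is_biproduct (A B S : C) (iA : hom A S) (iB : hom B S)
    (pA : hom S A) (pB : hom S B) : Prop :=
  [/\ pA \oc iA = idm A, pB \oc iB = idm B, pB \oc iA = 0, pA \oc iB = 0
    & iA \oc pA + iB \oc pB = idm S].

Definition is_coproduct (I : Type) (X : I -> C) (S : C)
    (inj : forall i, hom (X i) S) : Prop :=
  forall (Y : C) (f : forall i, hom (X i) Y),
    exists! h : hom S Y, forall i, h \oc inj i = f i.

(* [small] selects the index types: [card_lt^~ alpha] for fewer than [alpha]
   summands, [countable_type] for fewer than aleph_1. *)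
Definition has_coproducts (small : Type -> Prop) : Prop :=
  forall I : Type, small I -> forall X : I -> C,
    exists (S : C) (inj : forall i, hom (X i) S), is_coproduct inj.

(* Closure under small coproducts includes their existence; this matters only
   when the ambient category is not itself assumed to have them. *)
Definition smashing (small : Type -> Prop) (P : C -> Prop) : Prop :=
  forall I : Type, small I -> forall X : I -> C, (forall i, P (X i)) ->
    (exists (S : C) (inj : forall i, hom (X i) S), is_coproduct inj) /\
    (forall (S : C) (inj : forall i, hom (X i) S), is_coproduct inj -> P S).

End CategoryNotions.

Section Cardinals.
Local Open Scope classical_set_scope.
Local Open Scope card_scope.

Definition card_lt (I A : Type) : Prop :=
  ([set: I] #<= [set: A]) /\ ~ ([set: A] #<= [set: I]).

Definition countable_type (I : Type) : Prop := countable [set: I].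

(* Regular: not a sum of fewer than [A] cardinals smaller than [A]. *)
Definition infinite_regular (A : Type) : Prop :=
  infinite_set [set: A] /\
  forall (I : Type) (J : I -> Type), card_lt I A -> (forall i, card_lt (J i) A) ->
    ~ ([set: {i : I & J i}] #= [set: A]).

End Cardinals.

Record functor (C D : preadditive) := Functor {
  fobj :> C -> D;
  fmap : forall X Y : C, hom X Y -> hom (fobj X) (fobj Y);
  fmap1 : forall X : C, fmap (idm X) = idm (fobj X);
  fmapM : forall (X Y Z : C) (g : hom Y Z) (f : hom X Y),
    fmap (g \oc f) = fmap g \oc fmap f
}.

Arguments fmap {C D} f {X Y} g : rename.

Definition adjoint (C D : preadditive) (F : functor C D) (G : functor D C) : Prop :=
  exists phi : forall (X : C) (Y : D), hom (F X) Y -> hom X (G Y),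
    (forall X Y, bijective (phi X Y)) /\
    (forall (X X' : C) (Y Y' : D) (a : hom X' X) (b : hom Y Y') (f : hom (F X) Y),
       phi X' Y' (b \oc f \oc fmap F a) = fmap G b \oc phi X Y f \oc a).

Definition preserves_coproducts (small : Type -> Prop) (C D : preadditive)
    (F : functor C D) : Prop :=
  forall I : Type, small I ->
    forall (X : I -> C) (S : C) (inj : forall i, hom (X i) S),
      is_coproduct inj -> is_coproduct (fun i => fmap F (inj i)).

(* The shift is an additive autoequivalence: fully faithful, together with a
   chosen preimage [unshift X] of each [X] up to isomorphism. A strict
   automorphism is a special case. *)
Record triangulated := Triangulated {
  tricat :> preadditive;
  zero_ex : exists Z : tricat, is_zero Z;
  biproduct_ex : forall A B : tricat, exists (S : tricat) (iA : hom A S)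
    (iB : hom B S) (pA : hom S A) (pB : hom S B), is_biproduct iA iB pA pB;
  shift : tricat -> tricat;
  shiftm : forall X Y : tricat, hom X Y -> hom (shift X) (shift Y);
  shiftm1 : forall X : tricat, shiftm (idm X) = idm (shift X);
  shiftmM : forall (X Y Z : tricat) (g : hom Y Z) (f : hom X Y),
    shiftm (g \oc f) = shiftm g \oc shiftm f;
  shiftmD : forall (X Y : tricat) (f g : hom X Y),
    shiftm (f + g) = shiftm f + shiftm g;
  shiftm_bij : forall X Y : tricat, bijective (@shiftm X Y);
  unshift : tricat -> tricat;
  unshiftK : forall X : tricat, isomorphic (shift (unshift X)) X;
  dist : forall X Y Z : tricat, hom X Y -> hom Y Z -> hom Z (shift X) -> Prop;
  dist_iso : forall (X Y Z X' Y' Z' : tricat)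
    (f : hom X Y) (g : hom Y Z) (h : hom Z (shift X))
    (f' : hom X' Y') (g' : hom Y' Z') (h' : hom Z' (shift X'))
    (a : hom X X') (b : hom Y Y') (c : hom Z Z'),
    is_iso a -> is_iso b -> is_iso c ->
    b \oc f = f' \oc a -> c \oc g = g' \oc b -> shiftm a \oc h = h' \oc c ->
    dist f g h -> dist f' g' h';
  dist_id : forall X Z : tricat, is_zero Z ->
    dist (idm X) (0 : hom X Z) (0 : hom Z (shift X));
  dist_cone : forall (X Y : tricat) (f : hom X Y),
    exists (Z : tricat) (g : hom Y Z) (h : hom Z (shift X)), dist f g h;
  dist_rot : forall (X Y Z : tricat)
    (f : hom X Y) (g : hom Y Z) (h : hom Z (shift X)),
    dist f g h <-> dist g h (- shiftm f);
  dist_fill : forall (X Y Z X' Y' Z' : tricat)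
    (f : hom X Y) (g : hom Y Z) (h : hom Z (shift X))
    (f' : hom X' Y') (g' : hom Y' Z') (h' : hom Z' (shift X'))
    (a : hom X X') (b : hom Y Y'),
    dist f g h -> dist f' g' h' -> b \oc f = f' \oc a ->
    exists c : hom Z Z', c \oc g = g' \oc b /\ shiftm a \oc h = h' \oc c;
  dist_octahedron : forall (X Y Z X' Y' Z' : tricat)
    (f : hom X Y) (f1 : hom Y Z') (f2 : hom Z' (shift X))
    (g : hom Y Z) (g1 : hom Z X') (g2 : hom X' (shift Y))
    (k1 : hom Z Y') (k2 : hom Y' (shift X)),
    dist f f1 f2 -> dist g g1 g2 -> dist (g \oc f) k1 k2 ->
    exists (u : hom Z' Y') (v : hom Y' X'),
      dist u v (shiftm f1 \oc g2) /\
      [/\ u \oc f1 = k1 \oc g, k2 \oc u = f2, v \oc k1 = g1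
        & g2 \oc v = shiftm f \oc k2]
}.

Arguments shift {t} X.
Arguments shiftm {t X Y} f : rename.
Arguments unshift {t} X.
Arguments dist {t X Y Z} f g h : rename.

Definition shiftz (C : triangulated) (X : C) (i : int) : C :=
  match i with
  | Posz n => iter n shift X
  | Negz n => iter n.+1 unshift X
  end.

Section TriangulatedNotions.
Variable C : triangulated.

(* The class P[i], closed under isomorphism since the shift is only an
   equivalence. *)
Definition shift_class (P : C -> Prop) (i : int) (M : C) : Prop :=
  exists X : C, P X /\ isomorphic M (shiftz X i).

Definition ext_closed (P : C -> Prop) : Prop :=
  (forall Z : C, is_zero Z -> P Z) /\
  (forall (A M B : C) (f : hom A M) (g : hom M B) (h : hom B (shift A)),
     dist f g h -> P A -> P B -> P M).

(* The object class of <P>^{aleph_1}. *)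
Definition gen_aleph1 (P : C -> Prop) (M : C) : Prop :=
  forall Q : C -> Prop,
    ext_closed Q -> smashing countable_type Q ->
    (forall (i : int) (X : C), shift_class P i X -> Q X) -> Q M.

Definition is_hocolim (Y : nat -> C) (phi : forall i, hom (Y i) (Y i.+1))
    (H : C) : Prop :=
  exists (S : C) (inj : forall i, hom (Y i) S) (d : hom S S)
         (g : hom S H) (h : hom H (shift S)),
    [/\ is_coproduct inj,
        forall i, d \oc inj i = inj i - inj i.+1 \oc phi i
      & dist d g h].

(* Object classes of (strictly) full triangulated subcategories. *)
Record triangulated_sub (P : C -> Prop) : Prop := TriangulatedSub {
  tsub_zero : forall Z : C, is_zero Z -> P Z;
  tsub_shift : forall X : C, P X -> P (shift X);
  tsub_unshift : forall X : C, P X -> P (unshift X);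
  tsub_cone : forall (X Y Z : C) (f : hom X Y) (g : hom Y Z)
    (h : hom Z (shift X)), dist f g h -> P X -> P Y -> P Z
}.

End TriangulatedNotions.

Definition exact (C D : triangulated) (F : functor C D) : Prop :=
  (forall (X Y : C) (f g : hom X Y), fmap F (f + g) = fmap F f + fmap F g) /\
  exists theta : forall X : C, hom (F (shift X)) (shift (F X)),
    [/\ forall X, is_iso (theta X),
        forall (X Y : C) (f : hom X Y),
          theta Y \oc fmap F (shiftm f) = shiftm (fmap F f) \oc theta X
      & forall (X Y Z : C) (f : hom X Y) (g : hom Y Z) (h : hom Z (shift X)),
          dist f g h -> dist (fmap F f) (fmap F g) (theta X \oc fmap F h)].

Section Additivity.
Variable C : preadditive.
Implicit Types X Y Z : C.

Lemma comp0m X Y Z (f : hom X Y) : (0 : hom Y Z) \oc f = 0.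
Proof. by apply: (addrI (0 \oc f)); rewrite -compDl !addr0. Qed.

Lemma compm0 X Y Z (g : hom Y Z) : g \oc (0 : hom X Y) = 0.
Proof. by apply: (addrI (g \oc 0)); rewrite -compDr !addr0. Qed.

Lemma compNl X Y Z (g : hom Y Z) (f : hom X Y) : (- g) \oc f = - (g \oc f).
Proof. by apply: (addrI (g \oc f)); rewrite -compDl !subrr comp0m. Qed.

Lemma compNr X Y Z (g : hom Y Z) (f : hom X Y) : g \oc (- f) = - (g \oc f).
Proof. by apply: (addrI (g \oc f)); rewrite -compDr !subrr compm0. Qed.

End Additivity.

Section TriangleFacts.
Variable C : triangulated.
Implicit Types X Y Z : C.

Lemma shiftm0 X Y : shiftm (0 : hom X Y) = 0.
Proof. by apply: (addrI (shiftm 0)); rewrite -shiftmD !addr0. Qed.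

Lemma shiftmN X Y (f : hom X Y) : shiftm (- f) = - shiftm f.
Proof. by apply: (addrI (shiftm f)); rewrite -shiftmD !subrr shiftm0. Qed.

Lemma dist_comp0 X Y Z (f : hom X Y) (g : hom Y Z) (h : hom Z (shift X)) :
  dist f g h -> g \oc f = 0.
Proof.
move=> d; have [N zN] := zero_ex C.
have [c [<- _]] := dist_fill (a := idm X) (b := f) (dist_id X zN) d erefl.
by rewrite compm0.
Qed.

Lemma is_zero_shift Z : is_zero Z -> is_zero (shift Z).
Proof.
move=> zZ; have e : idm (shift Z) = 0.
  by rewrite -shiftm1 ((zZ Z).1 (idm Z)) shiftm0.
move=> X; split=> f; first by rewrite -[f]comp1m e comp0m.
by rewrite -[f]compm1 e compm0.
Qed.

Lemma dist_weak_coker X Y Z W (f : hom X Y) (g : hom Y Z)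
    (h : hom Z (shift X)) (k : hom Y W) :
  dist f g h -> k \oc f = 0 -> exists l : hom Z W, k = l \oc g.
Proof.
move=> d kf; have [N zN] := zero_ex C.
have dW : dist (0 : hom N W) (idm W) (0 : hom W (shift N)).
  apply/dist_rot; rewrite shiftm0 oppr0.
  exact: dist_id (is_zero_shift zN).
have [|l [lg _]] := dist_fill (a := 0) (b := k) d dW; first by rewrite kf comp0m.
by exists l; rewrite lg comp1m.
Qed.

Lemma dist_weak_ker X Y Z W (f : hom X Y) (g : hom Y Z)
    (h : hom Z (shift X)) (k : hom W Y) :
  dist f g h -> g \oc k = 0 -> exists l : hom W X, k = f \oc l.
Proof.
move=> /dist_rot d gk; have [N zN] := zero_ex C.
have /dist_rot dW := dist_id W zN.
have [|c [_]] := dist_fill (a := k) (b := 0) dW d; first by rewrite gk comp0m.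
have [s sK Ks] := shiftm_bij W X.
rewrite compNr compNl shiftm1 compm1 => /oppr_inj kc.
exists (s c); apply: (bij_inj (shiftm_bij W Y)).
by rewrite shiftmM Ks.
Qed.

Lemma dist0_biproduct X A B S (i : hom A S) (p : hom S (shift X)) :
  dist (0 : hom X A) i p -> isomorphic (shift X) B ->
  exists (iA : hom A S) (iB : hom B S) (pA : hom S A) (pB : hom S B),
    is_biproduct iA iB pA pB.
Proof.
move=> d [b [b' [b'b bb']]].
have d1 := (dist_rot _ _ _).1 d; have d2 := (dist_rot _ _ _).1 d1.
have [|r ri] := dist_weak_coker (k := idm A) d; first exact: compm0.
have [|s ps] := dist_weak_ker (k := idm (shift X)) d2.
  by rewrite shiftm0 oppr0 comp0m.
have pi := dist_comp0 d1.
pose r' := r - r \oc s \oc p.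
have r'i : r' \oc i = idm A by rewrite compDl compNl -compA pi compm0 subr0 -ri.
have r's : r' \oc s = 0 by rewrite compDl compNl -compA -ps compm1 subrr.
exists i, (s \oc b'), r', (b \oc p); split.
- exact: r'i.
- by rewrite -compA [p \oc _]compA -ps comp1m.
- by rewrite -compA pi compm0.
- by rewrite compA r's comp0m.
rewrite -compA [b' \oc _]compA b'b comp1m.
pose e := idm S - (i \oc r' + s \oc p).
suff /subr0_eq : e = 0 by [].
have [|g eg] := dist_weak_coker (k := e) d1.
  rewrite compDl compNl compDl -!compA r'i pi compm0 compm1 comp1m addr0.
  exact: subrr.
have : e \oc s = 0.
  rewrite compDl compNl compDl -!compA r's -ps compm0 compm1 comp1m add0r.
  exact: subrr.
by rewrite eg -compA -ps compm1 => ->; rewrite comp0m.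
Qed.

End TriangleFacts.

Lemma is_zeroP (D : preadditive) (Z : D) : is_zero Z <-> idm Z = 0.
Proof.
split=> [zZ|e X]; first exact: (zZ Z).1.
by split=> f; [rewrite -[f]comp1m e comp0m | rewrite -[f]compm1 e compm0].
Qed.

Section FullSubcategory.
Variables (C : triangulated) (P : C -> Prop) (HP : triangulated_sub P).

Definition full_preadditive : preadditive := {|
  obj := {X : C | P X};
  hom := fun X Y => hom (sval X) (sval Y);
  idm := fun X => idm (sval X);
  comp := fun X Y Z g f => g \oc f;
  comp1m := fun X Y f => comp1m f;
  compm1 := fun X Y f => compm1 f;
  compA := fun X Y Z T h g f => compA h g f;
  compDl := fun X Y Z g g' f => compDl g g' f;
  compDr := fun X Y Z g f f' => compDr g f f'
|}.

Local Notation D := full_preadditive.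

Definition sub_shift (X : D) : D :=
  exist P (shift (sval X)) (tsub_shift HP (svalP X)).

Definition sub_unshift (X : D) : D :=
  exist P (unshift (sval X)) (tsub_unshift HP (svalP X)).

Lemma sub_zero_ex : exists Z : D, is_zero Z.
Proof.
have [Z zZ] := zero_ex C.
by exists (exist P Z (tsub_zero HP zZ)); apply/is_zeroP; exact: (is_zeroP Z).1 zZ.
Qed.

Lemma sub_dist_id (X Z : D) : is_zero Z ->
  dist (idm (sval X)) (0 : hom (sval X) (sval Z)) 0.
Proof. by move=> /is_zeroP zZ; apply: dist_id; apply/is_zeroP. Qed.

Lemma sub_dist_cone (X Y : D) (f : hom X Y) :
  exists (Z : D) (g : hom Y Z) (h : hom Z (sub_shift X)),
    dist (f : hom (sval X) (sval Y)) g h.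
Proof.
have [Z [g [h d]]] := dist_cone (f : hom (sval X) (sval Y)).
by exists (exist P Z (tsub_cone HP d (svalP X) (svalP Y))), g, h.
Qed.

Lemma sub_biproduct_ex (A B : D) : exists (S : D) (iA : hom A S)
  (iB : hom B S) (pA : hom S A) (pB : hom S B), is_biproduct iA iB pA pB.
Proof.
have [S [i [p d]]] := dist_cone (0 : hom (unshift (sval B)) (sval A)).
have [iA [iB [pA [pB sum]]]] := dist0_biproduct d (unshiftK (sval B)).
have PS := tsub_cone HP d (tsub_unshift HP (svalP B)) (svalP A).
by exists (exist P S PS), iA, iB, pA, pB.
Qed.

Definition full_sub : triangulated := {|
  tricat := full_preadditive;
  zero_ex := sub_zero_ex;
  biproduct_ex := sub_biproduct_ex;
  shift := sub_shift;
  shiftm := fun X Y (f : @hom D X Y) => shiftm (f : hom (sval X) (sval Y));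
  shiftm1 := fun X => shiftm1 (sval X);
  shiftmM := fun X Y Z g f => shiftmM g f;
  shiftmD := fun X Y f g => shiftmD f g;
  shiftm_bij := fun X Y => shiftm_bij (sval X) (sval Y);
  unshift := sub_unshift;
  unshiftK := fun X => unshiftK (sval X);
  dist := fun X Y Z (f : @hom D X Y) (g : @hom D Y Z) (h : @hom D Z (sub_shift X)) =>
    dist (f : hom (sval X) (sval Y)) (g : hom (sval Y) (sval Z)) h;
  dist_iso := fun X Y Z X' Y' Z' f g h f' g' h' a b c =>
    @dist_iso C _ _ _ _ _ _ f g h f' g' h' a b c;
  dist_id := sub_dist_id;
  dist_cone := sub_dist_cone;
  dist_rot := fun X Y Z f g h => @dist_rot C _ _ _ f g h;
  dist_fill := fun X Y Z X' Y' Z' f g h f' g' h' a b =>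
    @dist_fill C _ _ _ _ _ _ f g h f' g' h' a b;
  dist_octahedron := fun X Y Z X' Y' Z' f f1 f2 g g1 g2 k1 k2 =>
    @dist_octahedron C _ _ _ _ _ _ f f1 f2 g g1 g2 k1 k2
|}.

Definition incl : functor full_sub C := {|
  fobj := fun X : full_sub => sval X;
  fmap := fun X Y f => f;
  fmap1 := fun X => erefl;
  fmapM := fun X Y Z g f => erefl
|}.

Definition in_ambient (Q : full_sub -> Prop) (M : C) : Prop :=
  exists X : full_sub, Q X /\ incl X = M.

End FullSubcategory.

Section WeightAxioms.
Variables (C : triangulated) (le0 ge0 : C -> Prop).

Record weight_axioms : Prop := WeightAxioms {
  w_retract_le : retract_closed le0;
  w_retract_ge : retract_closed ge0;
  w_shift_le : forall X : C, le0 X -> shift_class le0 1 X;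
  w_shift_ge : forall X : C, shift_class ge0 1 X -> ge0 X;
  w_orth : forall X Y : C, le0 X -> shift_class ge0 1 Y ->
    forall f : hom X Y, f = 0;
  w_dec : forall M : C, exists (L R : C) (f : hom L M) (g : hom M R)
    (h : hom R (shift L)), [/\ dist f g h, le0 L & shift_class ge0 1 R]
}.

End WeightAxioms.

Record weight_structure (C : triangulated) := WeightStructure {
  wle0 : C -> Prop;
  wge0 : C -> Prop;
  weight_axiomsP : weight_axioms wle0 wge0
}.

Section WeightNotions.
Variables (C : triangulated) (w : weight_structure C).

Definition wle (i : int) : C -> Prop := shift_class (wle0 w) i.
Definition wge (i : int) : C -> Prop := shift_class (wge0 w) i.

Definition weight_decomposition (m : int) (M L R : C)
    (f : hom L M) (g : hom M R) (h : hom R (shift L)) : Prop :=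
  [/\ dist f g h, wle m L & wge (m + 1) R].

Definition ws_smashing (small : Type -> Prop) : Prop :=
  has_coproducts C small /\ smashing small (wge0 w).

(* Object classes of C_-, C_{a-} and C_{+infty}. *)
Definition bounded_above (M : C) : Prop := exists i : int, wle i M.
Definition almost_bounded_above : C -> Prop := gen_aleph1 bounded_above.
Definition left_degenerate (M : C) : Prop := forall l : int, wge l M.

Section Restriction.
Variables (P : C -> Prop) (HP : triangulated_sub P).

Definition restricts : Prop :=
  @weight_axioms (full_sub HP)
    (fun X => wle0 w (incl HP X)) (fun X => wge0 w (incl HP X)).

Definition restriction (H : restricts) : weight_structure (full_sub HP) :=
  WeightStructure H.

End Restriction.
End WeightNotions.

Definition weight_exact (C D : triangulated) (wC : weight_structure C)
    (wD : weight_structure D) (F : functor C D) : Prop :=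
  [/\ exact F, forall X : C, wle0 wC X -> wle0 wD (F X)
    & forall X : C, wge0 wC X -> wge0 wD (F X)].

(* Main.v *)
Require Import Defs.
From mathcomp Require Import all_boot ssralg ssrint.
From mathcomp Require Import boolp.
From mathcomp Require cardinality.

(** Write [A] for the almost bounded above objects and [B] for the left degenerate
    ones. The theorem says that [A] and [B] form a semiorthogonal decomposition of
    [C], and describes its first projection by weight truncations.

    Orthogonality ([almost_bounded_above_orth]): a bounded above object has no
    nonzero morphisms to [B], and the objects with this property are closed under
    extensions and countable coproducts.

    Existence of decompositions ([hocolim_cone_degenerate]): let [H] be the homotopy
    colimit of the truncations [W i] of [M] at the weights [i >= 0]. It lies in [A]
    by construction, and the cone of [H -> M] is left degenerate if and only if
    [Hom(X, H) -> Hom(X, M)] is bijective for all bounded above [X]. Both [H] and [M]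
    are cones of telescope morphisms, on the coproduct [S] of the [W i] and on the
    coproduct [T] of copies of [M]. The cone of [S -> T] is the coproduct of the
    complementary parts [V i] ([cone_coprod]), whose weights are at least [1]; as the
    classes of objects of weight at least [i] are closed under countable coproducts,
    discarding the first terms of the telescope makes the weights of this cone as
    large as desired, in particular large compared with those of [X]
    ([telescope_orth]).

    The rest is formal. Orthogonality makes the two outer morphisms of the triangle
    [K -> M -> N] a coreflection to [A] and a reflection to [B], whence the adjoints
    and the uniqueness of the triangle; the adjoints are exact by the five lemma for [Hom(A, -)] and
    [Hom(-, B)] ([coreflection_cone], [reflection_cone]). An object left orthogonal to
    [B] has [N = 0], so [A] is the left orthogonal of [B], hence closed under all
    coproducts. The coreflection of [M] has weights at least [0] if [M] does, because
    it is an extension of [M] by a shift of a left degenerate object; the same argument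
    applies to the [W i]. Finally, if [B] has coproducts of a given size and they are
    coproducts in [C], then the reflection of a coproduct is the coproduct of the
    reflections, and so is the coreflection, by [cone_coprod] ([coreflect_coprod]). *)

Set Implicit Arguments.
Unset Strict Implicit.
Unset Printing Implicit Defensive.

Import GRing.Theory.
Local Open Scope ring_scope.

(** * Isomorphisms and triangles *)

Section Isomorphisms.
Variable C : preadditive.
Implicit Types X Y Z T : C.

Lemma compmA X Y Z T (h : hom Z T) (g : hom Y Z) (f : hom X Y) :
  h \oc (g \oc f) = h \oc g \oc f.
Proof. exact: Defs.compA. Qed.

Lemma compBl X Y Z (g g' : hom Y Z) (f : hom X Y) :
  (g - g') \oc f = g \oc f - g' \oc f.
Proof. by rewrite compDl compNl. Qed.

Lemma compBr X Y Z (g : hom Y Z) (f f' : hom X Y) :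
  g \oc (f - f') = g \oc f - g \oc f'.
Proof. by rewrite compDr compNr. Qed.

Lemma is_iso_id X : is_iso (idm X).
Proof. by exists (idm X); rewrite comp1m. Qed.

Lemma isomorphic_refl X : isomorphic X X.
Proof. by exists (idm X); exact: is_iso_id. Qed.

Lemma isomorphic_sym X Y : isomorphic X Y -> isomorphic Y X.
Proof. by move=> [f [g [gf fg]]]; exists g, f. Qed.

Lemma isomorphic_trans X Y Z :
  isomorphic X Y -> isomorphic Y Z -> isomorphic X Z.
Proof.
move=> [f [f' [f'f ff']]] [g [g' [g'g gg']]]; exists (g \oc f), (f' \oc g').
by split; [rewrite -compmA [g' \oc _]compmA g'g comp1m
          |rewrite -compmA [f \oc _]compmA ff' comp1m].
Qed.

Definition iso_closed (P : C -> Prop) : Prop :=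
  forall X Y, isomorphic X Y -> P X -> P Y.

Lemma retract_iso_closed (P : C -> Prop) : retract_closed P -> iso_closed P.
Proof. by move=> rP X Y [f [g [gf fg]]]; apply: rP; exists g, f. Qed.

Lemma left_orth_iso_closed (P : C -> Prop) : iso_closed (left_orth P).
Proof.
move=> X Y [f [g [gf fg]]] oX N PN h.
by rewrite -[h]compm1 -fg compmA (oX N PN (h \oc f)) comp0m.
Qed.

End Isomorphisms.

Section Shift.
Variable C : triangulated.
Implicit Types X Y Z : C.

Lemma shiftm_inj X Y : injective (@shiftm C X Y).
Proof. exact: bij_inj (shiftm_bij X Y). Qed.

Lemma shiftm_full X Y (F : hom (shift X) (shift Y)) : exists f, F = shiftm f.
Proof. by have [s _ Ks] := shiftm_bij X Y; exists (s F). Qed.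

Lemma shiftm_iso X Y (f : hom X Y) : is_iso f -> is_iso (shiftm f).
Proof.
by move=> [g [gf fg]]; exists (shiftm g); rewrite -!shiftmM gf fg !shiftm1.
Qed.

Lemma isomorphic_shift X Y : isomorphic (shift X) (shift Y) <-> isomorphic X Y.
Proof.
split=> [[F [G]]|[f /shiftm_iso]]; last by exists (shiftm f).
have [f ->] := shiftm_full F; have [g ->] := shiftm_full G.
rewrite -!shiftmM -!shiftm1 => -[/shiftm_inj gf /shiftm_inj fg].
by exists f, g.
Qed.

Lemma isomorphic_unshift_shift X : isomorphic (unshift (shift X)) X.
Proof. by apply/isomorphic_shift; exact: unshiftK. Qed.

Lemma dist_shift X Y Z (f : hom X Y) (g : hom Y Z) (h : hom Z (shift X)) :
  dist f g h <-> dist (- shiftm f) (- shiftm g) (- shiftm h).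
Proof. by rewrite 3!dist_rot. Qed.

Section Triangle.
Variables (X Y Z : C) (f : hom X Y) (g : hom Y Z) (h : hom Z (shift X)).
Hypothesis d : dist f g h.
Let d1 : dist g h (- shiftm f) := (dist_rot _ _ _).1 d.
Let d2 : dist h (- shiftm f) (- shiftm g) := (dist_rot _ _ _).1 d1.

Lemma dist_coker_g W (k : hom Z W) : k \oc g = 0 -> exists l, k = l \oc h.
Proof. exact: dist_weak_coker d1. Qed.

Lemma dist_coker_h W (k : hom (shift X) W) :
  k \oc h = 0 -> exists l, k = l \oc shiftm f.
Proof.
by case/(dist_weak_coker d2)=> l ->; exists (- l); rewrite compNl compNr.
Qed.

Lemma dist_ker_h W (k : hom W Z) : h \oc k = 0 -> exists l, k = g \oc l.
Proof. exact: dist_weak_ker d1. Qed.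

Lemma dist_ker_sf W (k : hom W (shift X)) :
  shiftm f \oc k = 0 -> exists l, k = h \oc l.
Proof. by move=> fk; apply: (dist_weak_ker d2); rewrite compNl fk oppr0. Qed.

Lemma dist_comp_sfh : shiftm f \oc h = 0.
Proof. by apply: oppr_inj; rewrite oppr0 -compNl (dist_comp0 d2). Qed.

(** A morphism killed by the first edge of a triangle comes from the third
    vertex shifted back; stated for its shift, to avoid desuspending. *)
Lemma dist_ker_f W (k : hom W X) :
  f \oc k = 0 -> exists l : hom (shift W) Z, shiftm k = h \oc l.
Proof. by move=> fk; apply: dist_ker_sf; rewrite -shiftmM fk shiftm0. Qed.

Lemma left_orth_ext (P : C -> Prop) :
  left_orth P X -> left_orth P Z -> left_orth P Y.
Proof.
move=> oX oZ N PN k.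
have [l ->] := dist_weak_coker d (oX N PN (k \oc f)).
by rewrite (oZ N PN l) comp0m.
Qed.

Lemma dist_third_zero_iso : is_zero Z -> is_iso f.
Proof.
move=> zZ; have [r fr] := dist_weak_ker (k := idm Y) d ((zZ _).1 _).
exists r; split=> //; apply/eqP; rewrite -subr_eq0; apply/eqP.
have [|l] := @dist_ker_f _ (r \oc f - idm X).
  by rewrite compBr compmA -fr comp1m compm1 subrr.
by rewrite ((zZ _).1 l) compm0 -(shiftm0 X X) => /shiftm_inj.
Qed.

Lemma dist_first_zero_iso : is_zero X -> is_iso g.
Proof.
move=> zX.
have [|r rg] := dist_weak_coker (k := idm Y) d; first exact: (zX _).2.
exists r; split=> //; apply/eqP; rewrite -subr_eq0; apply/eqP.
have [|l ->] := @dist_coker_g _ (g \oc r - idm Z).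
  by rewrite compBl -compmA -rg comp1m compm1 subrr.
by rewrite ((is_zero_shift zX _).1 h) compm0.
Qed.

End Triangle.

Lemma iso_dist X Y Z (f : hom X Y) :
  is_iso f -> is_zero Z -> dist f (0 : hom Y Z) 0.
Proof.
move=> fi zZ; apply: (dist_iso (a := idm X) (b := f) (c := idm Z)) (dist_id X zZ);
  rewrite ?compm0 ?comp0m //; exact: is_iso_id.
Qed.

Lemma ext_closed_iso (P : C -> Prop) : ext_closed P -> iso_closed P.
Proof.
move=> [P0 Pext] X Y [f fi] PX; have [Z zZ] := zero_ex C.
exact: Pext (iso_dist fi zZ) PX (P0 Z zZ).
Qed.

Section TriangulatedSub.
Variables (P : C -> Prop) (HP : triangulated_sub P).

Lemma tsub_iso : iso_closed P.
Proof.
move=> X Y [f fi] PX; have [Z zZ] := zero_ex C.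
have /dist_rot d := iso_dist (is_iso_id X) (is_zero_shift zZ).
have d' : dist (0 : hom Z X) f 0.
  apply/dist_rot; rewrite shiftm0 oppr0.
  exact: iso_dist fi (is_zero_shift zZ).
exact: (tsub_cone HP d' (tsub_zero HP zZ) PX).
Qed.

Lemma tsub_of_shift X : P (shift X) -> P X.
Proof.
by move=> /(tsub_unshift HP); apply: tsub_iso; exact: isomorphic_unshift_shift.
Qed.

End TriangulatedSub.

End Shift.

(** * Coproducts and cones *)

Lemma dependent_choice (I : Type) (T : I -> Type) (P : forall i, T i -> Prop) :
  (forall i, exists x, P i x) -> exists f : forall i, T i, forall i, P i (f i).
Proof.
by move=> H; exists (fun i => sval (cid (H i))) => i; exact: svalP (cid (H i)).
Qed.

Section Coproducts.
Variables (C : preadditive) (I : Type) (X : I -> C).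
Implicit Types S T Y : C.

Lemma coprod_ext S (inj : forall i, hom (X i) S) Y (h h' : hom S Y) :
  is_coproduct inj -> (forall i, h \oc inj i = h' \oc inj i) -> h = h'.
Proof.
move=> cS hh'; have [k [_ ku]] := cS _ (fun i => h' \oc inj i).
by rewrite -(ku h hh') (ku h').
Qed.

Lemma coprod_mor S (inj : forall i, hom (X i) S) Y (f : forall i, hom (X i) Y) :
  is_coproduct inj -> exists h : hom S Y, forall i, h \oc inj i = f i.
Proof. by move=> /(_ _ f) [h [hf _]]; exists h. Qed.

Lemma is_coproductI S (inj : forall i, hom (X i) S) :
  (forall Y (f : forall i, hom (X i) Y),
     exists h : hom S Y, forall i, h \oc inj i = f i) ->
  (forall Y (h : hom S Y), (forall i, h \oc inj i = 0) -> h = 0) ->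
  is_coproduct inj.
Proof.
move=> exS unS Y f; have [h hf] := exS Y f; exists h; split=> // h' h'f.
by apply/eqP; rewrite -subr_eq0; apply/eqP/unS => i; rewrite compBl hf h'f subrr.
Qed.

Lemma eq_coprod S (inj inj' : forall i, hom (X i) S) :
  (forall i, inj i = inj' i) -> is_coproduct inj -> is_coproduct inj'.
Proof.
move=> e cS; apply: is_coproductI => Y f.
  by have [h hf] := coprod_mor f cS; exists h => i; rewrite -e.
by move=> fi; apply: (coprod_ext cS) => i; rewrite e fi comp0m.
Qed.

Lemma coprod_iso S (inj : forall i, hom (X i) S) T (a : hom S T) :
  is_coproduct inj -> is_iso a -> is_coproduct (fun i => a \oc inj i).
Proof.
move=> cS [b [ba ab]]; apply: is_coproductI => Y f.
  have [h hf] := coprod_mor f cS; exists (h \oc b) => i.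
  by rewrite -compmA [b \oc _]compmA ba comp1m.
move=> fa; rewrite -[f]compm1 -ab compmA.
suff -> : f \oc a = 0 by rewrite comp0m.
by apply: (coprod_ext cS) => i; rewrite -compmA fa comp0m.
Qed.

Lemma left_orth_coprod (P : C -> Prop) S (inj : forall i, hom (X i) S) :
  is_coproduct inj -> (forall i, left_orth P (X i)) -> left_orth P S.
Proof.
move=> cS oX N PN f; apply: (coprod_ext cS) => i.
by rewrite (oX i N PN (f \oc _)) comp0m.
Qed.

End Coproducts.

Section ShiftedCoproducts.
Variables (C : triangulated) (I : Type).

Lemma coprod_shift (X : I -> C) S (inj : forall i, hom (X i) S) :
  is_coproduct inj <-> is_coproduct (fun i => shiftm (inj i)).
Proof.
split=> cS; apply: is_coproductI => Y f; last 1 first.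
- move=> fi; apply: shiftm_inj; apply: (coprod_ext cS) => i.
  by rewrite -shiftmM fi !shiftm0 comp0m.
- have [u [v [vu uv]]] := unshiftK Y.
  have [f' ff'] := dependent_choice (fun i => shiftm_full (v \oc f i)).
  have [h hf] := coprod_mor f' cS; exists (u \oc shiftm h) => i.
  by rewrite -compmA -shiftmM hf -ff' compmA uv comp1m.
- have [u [v [vu uv]]] := unshiftK Y.
  move=> fi; rewrite -[f]comp1m -uv -compmA.
  have [f' ff'] := shiftm_full (v \oc f); rewrite ff'.
  suff -> : f' = 0 by rewrite shiftm0 compm0.
  apply: (coprod_ext cS) => i; apply: shiftm_inj.
  by rewrite shiftmM -ff' -compmA fi comp0m compm0 shiftm0.
- have [h hf] := coprod_mor (fun i => shiftm (f i)) cS.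
  have [h' eh] := shiftm_full h; exists h' => i; apply: shiftm_inj.
  by rewrite shiftmM -eh hf.
Qed.

Lemma coprod_unshift (X : I -> C) S (inj : forall i, hom (X i) S) :
  is_coproduct inj ->
  exists inj' : forall i, hom (unshift (X i)) (unshift S), is_coproduct inj'.
Proof.
move=> cS; have [r [s [sr rs]]] := unshiftK S.
have [u hu] := dependent_choice (fun i => unshiftK (X i)).
have {hu} [v hv] := dependent_choice hu.
have [inj' hinj'] := dependent_choice (fun i => shiftm_full (s \oc inj i \oc u i)).
exists inj'; apply/coprod_shift; apply: is_coproductI => Y f.
  have [h hf] := coprod_mor (fun i => f i \oc v i) cS.
  exists (h \oc r) => i.
  rewrite -hinj' -!compmA [r \oc _]compmA rs comp1m compmA hf -compmA.
  by rewrite (hv i).1 compm1.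
move=> fi; rewrite -[f]compm1 -sr compmA.
suff -> : f \oc s = 0 by rewrite comp0m.
apply: (coprod_ext cS) => i; rewrite comp0m.
by rewrite -[LHS]compm1 -(hv i).2 compmA -!compmA [inj i \oc _]compmA
  [s \oc _]compmA [s \oc _]compmA hinj' [f \oc _]compmA fi comp0m.
Qed.

(** A map between coproducts, taken summandwise, has the coproduct of the
    summandwise cones as its cone: applying [Hom(-, U)] to the triangles gives
    exact sequences, and the universal property for the cones follows from the
    one for the sources and targets (and their shifts) as in the five lemma. *)
Lemma cone_coprod (X Y Z : I -> C) (f : forall i, hom (X i) (Y i))
    (g : forall i, hom (Y i) (Z i)) (h : forall i, hom (Z i) (shift (X i)))
    (S T K : C) (F : hom S T) (G : hom T K) (H : hom K (shift S))
    (iX : forall i, hom (X i) S) (iY : forall i, hom (Y i) T)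
    (iZ : forall i, hom (Z i) K) :
  (forall i, dist (f i) (g i) (h i)) -> dist F G H ->
  is_coproduct iX -> is_coproduct iY ->
  (forall i, F \oc iX i = iY i \oc f i) ->
  (forall i, iZ i \oc g i = G \oc iY i) ->
  (forall i, shiftm (iX i) \oc h i = H \oc iZ i) ->
  is_coproduct iZ.
Proof.
move=> d D cX cY Ff Gg Hh; have cX1 := (coprod_shift iX).1 cX.
have cY1 := (coprod_shift iY).1 cY.
apply: is_coproductI => U v.
  have [w hw] := coprod_mor (fun i => v i \oc g i) cY.
  have [|v' ev'] := dist_weak_coker (k := w) D.
    apply: (coprod_ext cX) => i; rewrite comp0m -compmA Ff compmA hw -compmA.
    by rewrite (dist_comp0 (d i)) compm0.
  have hx i : exists x, v i - v' \oc iZ i = x \oc h i.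
    apply: (dist_coker_g (d i)).
    by rewrite compBl -compmA Gg compmA -ev' hw subrr.
  have {hx} [x hx] := dependent_choice hx.
  have [y hy] := coprod_mor x cX1.
  exists (v' + y \oc H) => i.
  by rewrite compDl -compmA -Hh compmA hy -hx addrC subrK.
move=> vZ.
have [|x ex] := dist_coker_g D (k := v).
  by apply: (coprod_ext cY) => i; rewrite -compmA -Gg compmA vZ !comp0m.
have hy i : exists y, x \oc shiftm (iX i) = y \oc shiftm (f i).
  by apply: (dist_coker_h (d i)); rewrite -compmA Hh compmA -ex vZ.
have {hy} [y hy] := dependent_choice hy.
have [y' hy'] := coprod_mor y cY1.
suff ey : x = y' \oc shiftm F by rewrite ex ey -compmA (dist_comp_sfh D) compm0.
apply: (coprod_ext cX1) => i.
by rewrite hy -compmA -shiftmM Ff shiftmM compmA hy'.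
Qed.

End ShiftedCoproducts.

(** * Weights of objects *)

Lemma NegzS_succ (n : nat) : Negz n.+1 + 1 = Negz n.
Proof. by rewrite !NegzE [n.+2%:Z]intS opprD addrAC addNr add0r. Qed.

(** A property of all weights follows from the case of weight [0] once it is
    invariant under simultaneous shift of weights and objects. *)
Lemma int_step_ind (K : int -> Prop) :
  K 0 -> (forall i, K i <-> K (i + 1)) -> forall i, K i.
Proof.
move=> K0 KS; have Kpos (n : nat) : K n%:Z.
  elim: n => [//|n IHn]; rewrite -addn1 PoszD; exact: (KS _).1 IHn.
case=> [n|]; first exact: Kpos.
elim=> [|n IHn]; apply: (KS _).2; first exact: (Kpos 0%N).
by rewrite NegzS_succ.
Qed.

Lemma countable_nat : countable_type nat.
Proof. exact: cardinality.countableP. Qed.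

Section ShiftClasses.
Variable C : triangulated.
Implicit Types (P : C -> Prop) (X Y M : C) (i : int).

Lemma shiftz_succ X i : isomorphic (shiftz X (i + 1)) (shift (shiftz X i)).
Proof.
case: i => [n|[|n]].
- by rewrite -PoszD addn1 /=; exact: isomorphic_refl.
- by apply: isomorphic_sym; exact: unshiftK.
- by rewrite NegzS_succ; apply: isomorphic_sym; exact: unshiftK.
Qed.

Lemma shift_class_iso P i : iso_closed (shift_class P i).
Proof.
move=> X Y XY [X' [PX' XX']]; exists X'; split=> //.
exact: isomorphic_trans (isomorphic_sym XY) XX'.
Qed.

Lemma shift_class_shift P i M :
  shift_class P (i + 1) (shift M) <-> shift_class P i M.
Proof.
split=> -[X [PX MX]]; exists X; split=> //.
  by apply/isomorphic_shift; apply: isomorphic_trans MX (shiftz_succ X i).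
apply: isomorphic_trans (isomorphic_sym (shiftz_succ X i)).
exact/isomorphic_shift.
Qed.

Lemma shift_class_unshift P i M :
  shift_class P i (unshift M) <-> shift_class P (i + 1) M.
Proof.
rewrite -shift_class_shift; split; apply: shift_class_iso.
  exact: unshiftK.
by apply: isomorphic_sym; exact: unshiftK.
Qed.

Lemma shift_class0 P M : iso_closed P -> shift_class P 0 M <-> P M.
Proof.
move=> Pi; split=> [[X [PX MX]]|PM].
  exact: Pi (isomorphic_sym MX) PX.
by exists M; split=> //; exact: isomorphic_refl.
Qed.

Lemma retract_shift X Y : retract_of (shift X) (shift Y) <-> retract_of X Y.
Proof.
split=> [[i [r]]|[i [r ri]]].
  have [j ->] := shiftm_full i; have [s ->] := shiftm_full r.
  by rewrite -shiftmM -shiftm1 => /shiftm_inj sj; exists j, s.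
by exists (shiftm i), (shiftm r); rewrite -shiftmM ri shiftm1.
Qed.

Lemma retract_of_iso X X' Y Y' :
  isomorphic X X' -> isomorphic Y Y' -> retract_of X Y -> retract_of X' Y'.
Proof.
move=> [a [a' [_ aa']]] [b [b' [b'b _]]] [i [r ri]].
exists (b \oc i \oc a'), (a \oc r \oc b').
rewrite -!compmA [b' \oc _]compmA b'b comp1m [r \oc _]compmA ri comp1m.
exact: aa'.
Qed.

Lemma shift_class_retract P i : retract_closed P -> retract_closed (shift_class P i).
Proof.
move=> Pr; elim/int_step_ind: i => [|i].
  have Pi := retract_iso_closed Pr.
  by move=> X Y XY; rewrite !shift_class0 //; exact: Pr.
split=> IH X Y XY.
  rewrite -!shift_class_unshift; apply: IH; apply/retract_shift.
  apply: retract_of_iso XY; apply: isomorphic_sym; exact: unshiftK.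
by rewrite -!(shift_class_shift P i); apply: IH; apply/retract_shift.
Qed.

End ShiftClasses.

Section Weights.
Variables (C : triangulated) (w : weight_structure C).
Implicit Types (X Y M N : C) (i : int).
Let wax := weight_axiomsP w.

Lemma wle0_iso : iso_closed (wle0 w).
Proof. exact: retract_iso_closed (w_retract_le wax). Qed.

Lemma wge0_iso : iso_closed (wge0 w).
Proof. exact: retract_iso_closed (w_retract_ge wax). Qed.

Lemma wle_iso i : iso_closed (wle w i).
Proof. exact: shift_class_iso. Qed.

Lemma wle0E M : wle w 0 M <-> wle0 w M.
Proof. exact: shift_class0 wle0_iso. Qed.

Lemma wge0E M : wge w 0 M <-> wge0 w M.
Proof. exact: shift_class0 wge0_iso. Qed.

Lemma wle_shift i M : wle w (i + 1) (shift M) <-> wle w i M.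
Proof. exact: shift_class_shift. Qed.

Lemma wge_shift i M : wge w (i + 1) (shift M) <-> wge w i M.
Proof. exact: shift_class_shift. Qed.

Lemma wle_unshift i M : wle w i (unshift M) <-> wle w (i + 1) M.
Proof. exact: shift_class_unshift. Qed.

Lemma wge_unshift i M : wge w i (unshift M) <-> wge w (i + 1) M.
Proof. exact: shift_class_unshift. Qed.

Lemma wle_succ i M : wle w i M -> wle w (i + 1) M.
Proof.
elim/int_step_ind: i M => [M /wle0E|i].
  by rewrite add0r; exact: (w_shift_le wax).
split=> IH M; first by rewrite -(wle_unshift i) -(wle_unshift (i + 1)); exact: IH.
by rewrite -(wle_shift i) => /IH; rewrite wle_shift.
Qed.

Lemma wge_succ i M : wge w (i + 1) M -> wge w i M.
Proof.
elim/int_step_ind: i M => [M|i].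
  by rewrite add0r => /(w_shift_ge wax); rewrite wge0E.
split=> IH M; first by rewrite -(wge_unshift i) -(wge_unshift (i + 1)); exact: IH.
by rewrite -(wge_shift (i + 1)) => /IH; rewrite wge_shift.
Qed.

Lemma wle_leq (m n : nat) M : (m <= n)%N -> wle w m%:Z M -> wle w n%:Z M.
Proof.
move=> /subnK <- Mm; elim: (n - m)%N => [//|k IHk].
by rewrite addSn -addn1 PoszD; exact: wle_succ.
Qed.

Lemma wge_leq (m n : nat) M : (m <= n)%N -> wge w n%:Z M -> wge w m%:Z M.
Proof.
move=> /subnK <-; elim: (n - m)%N => [//|k IHk].
by rewrite addSn -addn1 PoszD => /wge_succ.
Qed.

Lemma bounded_aboveP M : bounded_above w M <-> exists n : nat, wle w n%:Z M.
Proof.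
split=> [[[n|n] Mi]|[n Mn]]; [by exists n | exists 0%N | by exists n%:Z].
by elim: n Mi => [//|n IHn] /wle_succ; [| rewrite NegzS_succ; exact: IHn].
Qed.

Lemma left_degenerateP M :
  left_degenerate w M <-> forall n : nat, wge w n%:Z M.
Proof.
split=> [dM n|dM [n|n]]; [exact: dM | exact: dM |].
elim: n => [|n IHn]; apply: wge_succ; [exact: (dM 0%N)|].
by rewrite NegzS_succ; exact: IHn.
Qed.

Lemma bounded_above_shift M : bounded_above w M -> bounded_above w (shift M).
Proof. by move=> [i Mi]; exists (i + 1); rewrite wle_shift. Qed.

Lemma bounded_above_of_shift M : bounded_above w (shift M) -> bounded_above w M.
Proof. by move=> [i Mi]; exists (i - 1); rewrite -wle_shift subrK. Qed.

Lemma bounded_above_iso : iso_closed (bounded_above w).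
Proof. by move=> X Y XY [i Xi]; exists i; exact: wle_iso XY Xi. Qed.

Lemma wle_orth i X Y : wle w i X -> wge w (i + 1) Y -> forall f : hom X Y, f = 0.
Proof.
elim/int_step_ind: i X Y => [X Y /wle0E Xle|i].
  by rewrite add0r => Yge; exact: (w_orth wax Xle Yge).
split=> IH X Y.
  rewrite -wle_unshift -(wge_unshift _ Y) => Xle Yge f.
  have [u [v [vu uv]]] := unshiftK X; have [u' [v' [vu' uv']]] := unshiftK Y.
  have [g eg] := shiftm_full (v' \oc f \oc u).
  have -> : f = u' \oc shiftm g \oc v.
    by rewrite -eg -!compmA uv compm1 compmA uv' comp1m.
  by rewrite (IH _ _ Xle Yge g) shiftm0 compm0 comp0m.
rewrite -wle_shift -(wge_shift _ Y) => Xle Yge f; apply: shiftm_inj.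
by rewrite shiftm0; exact: IH Xle Yge _.
Qed.

(** For the converse, take a weight decomposition of [N]: its first morphism
    vanishes, hence [N] is a retract of the part of larger weight. *)
Lemma wge_orthP i N :
  wge w (i + 1) N <-> forall X, wle w i X -> forall f : hom X N, f = 0.
Proof.
split=> [Nge X Xle|]; first exact: (wle_orth Xle Nge).
elim/int_step_ind: i N => [N oN|i].
  have [L [R [f [g [h [d Ll Rr]]]]]] := w_dec wax N.
  have [|r gr] := dist_weak_coker (k := idm N) d.
    by rewrite comp1m; apply: oN; exact/wle0E.
  apply: (shift_class_retract (w_retract_ge wax) _ Rr).
  by exists g, r.
split=> IH N oN.
  rewrite -wge_unshift; apply: IH => X Xle f; apply: shiftm_inj.
  have [u [v [vu uv]]] := unshiftK N.
  rewrite shiftm0 -[shiftm f]comp1m -vu -compmA.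
  by rewrite (oN (shift X) _ (u \oc shiftm f)) ?compm0 // wle_shift.
rewrite -wge_shift; apply: IH => X; rewrite -wle_unshift => Xle f.
have [u [v [vu uv]]] := unshiftK X.
rewrite -[f]compm1 -uv compmA.
have [g ->] := shiftm_full (f \oc u).
by rewrite (oN _ Xle g) shiftm0 comp0m.
Qed.

Lemma wge_ext i X Y Z (f : hom X Y) (g : hom Y Z) (h : hom Z (shift X)) :
  dist f g h -> wge w i X -> wge w i Z -> wge w i Y.
Proof.
move=> d; rewrite -(subrK 1 i) !wge_orthP => oX oZ U Ule k.
have [l ->] := dist_weak_ker d (oZ U Ule (g \oc k)).
by rewrite (oX U Ule l) compm0.
Qed.

Lemma wge_zero i Z : is_zero Z -> wge w i Z.
Proof. by move=> zZ; rewrite -(subrK 1 i) wge_orthP => X _; exact: (zZ X).1. Qed.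

Lemma wge_coprod small i I (X : I -> C) S (inj : forall j, hom (X j) S) :
  smashing small (wge0 w) -> small I ->
  is_coproduct inj -> (forall j, wge w i (X j)) -> wge w i S.
Proof.
move=> sm sI; elim/int_step_ind: i X S inj => [X S inj cS X0|i].
  by apply/wge0E; apply: (sm I sI X _).2 cS => j; apply/wge0E.
split=> IH X S inj cS Xi.
  have [inj' cS'] := coprod_unshift cS.
  by rewrite -wge_unshift; apply: IH cS' _ => j; rewrite wge_unshift.
have cS' := (coprod_shift inj).1 cS.
by rewrite -wge_shift; apply: IH cS' _ => j; rewrite wge_shift.
Qed.

Lemma weight_decomposition_ex (n : nat) M :
  exists (L R : C) (f : hom L M) (g : hom M R) (h : hom R (shift L)),
    weight_decomposition w n%:Z f g h.
Proof.
elim: n M => [|n IHn] M.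
  have [L [R [f [g [h [d Ll Rr]]]]]] := w_dec wax M.
  by exists L, R, f, g, h; split=> //; apply/wle0E.
have [L [R [f [g [h [/dist_shift d Ll Rr]]]]]] := IHn (unshift M).
have [u [v [vu uv]]] := unshiftK M.
exists (shift L), (shift R), (u \oc - shiftm f), (- shiftm g \oc v), (- shiftm h).
have eS : n.+1%:Z = n%:Z + 1 by rewrite -PoszD addn1.
split; [|by rewrite eS wle_shift|by rewrite eS wge_shift].
apply: (dist_iso (a := idm _) (b := u) (c := idm _)) d; rewrite ?compm1 ?comp1m //.
- exact: is_iso_id.
- by exists v.
- exact: is_iso_id.
- by rewrite -compmA vu compm1.
- by rewrite shiftm1 comp1m.
Qed.

Lemma left_degenerate_sub : triangulated_sub (left_degenerate w).
Proof.
have Bshift X : left_degenerate w X -> left_degenerate w (shift X).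
  by move=> dX l; rewrite -(subrK 1 l) wge_shift.
split=> // [Z zZ l|X dX l|X Y Z f g h d dX dY l].
- exact: wge_zero.
- by rewrite wge_unshift.
- exact: wge_ext ((dist_rot _ _ _).1 d) (dY l) (Bshift _ dX l).
Qed.

(** The left orthogonal of the left degenerate objects is closed under
    extensions and coproducts, and it contains the bounded above objects. *)
Lemma almost_bounded_above_orth M : has_coproducts C countable_type ->
  almost_bounded_above w M -> left_orth (left_degenerate w) M.
Proof.
move=> HC; apply.
- split=> [Z zZ N _|A X B f g h d]; [exact: (zZ N).2 | exact: (left_orth_ext d)].
- move=> I cI X oX; split; first exact: HC.
  by move=> S inj cS; exact: left_orth_coprod cS oX.
move=> i X [Y [Yb XY]] N dN; have [j Xj] : bounded_above w X.
  apply: bounded_above_iso (isomorphic_sym XY) _; clear X XY.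
  elim/int_step_ind: i => [//|i]; split=> Yi.
    apply: bounded_above_iso (isomorphic_sym (shiftz_succ Y i)) _.
    exact: bounded_above_shift.
  apply: bounded_above_of_shift.
  exact: bounded_above_iso (shiftz_succ Y i) Yi.
exact: wle_orth Xj (dN _).
Qed.

Lemma bounded_above_almost M : bounded_above w M -> almost_bounded_above w M.
Proof.
move=> Mb Q _ _; apply; apply/(shift_class0 (P := bounded_above w)) => //.
exact: bounded_above_iso.
Qed.

End Weights.

(** * Homotopy colimits of weight truncations *)

Section Telescope.
Variables (C : triangulated) (w : weight_structure C).
Hypotheses (HC : has_coproducts C countable_type)
  (Hw : smashing countable_type (wge0 w)).
Variable M : C.

(** [S] and [T] stand for the coproducts of the [W i] and of copies of [M],
    [d] and [e] for the two telescope morphisms, [J] for the coproduct of the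
    [j i]. If the cones [V i] are of large weight, so is the cone of [J], which
    is their coproduct, and [J] is bijective on morphisms from [X]. In general
    this holds only after dropping finitely many terms, hence the induction on
    [n]; modulo the image of [d], the identity of [S] factors through the
    coproduct of the [W i.+1]. *)
Lemma telescope_orth (n v x : nat) (X : C) (W V : nat -> C)
    (j : forall i, hom (W i) M) (k : forall i, hom M (V i))
    (l : forall i, hom (V i) (shift (W i))) (phi : forall i, hom (W i) (W i.+1))
    (S T : C) (inj : forall i, hom (W i) S) (injT : nat -> hom M T)
    (d : hom S S) (e : hom T T) (J : hom S T) :
  (x < v + n)%N -> (forall i, dist (j i) (k i) (l i)) ->
  (forall i, wge w (v + i)%N%:Z (V i)) ->
  (forall i, j i.+1 \oc phi i = j i) ->
  is_coproduct inj -> is_coproduct injT ->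
  (forall i, d \oc inj i = inj i - inj i.+1 \oc phi i) ->
  (forall i, e \oc injT i = injT i - injT i.+1) ->
  (forall i, J \oc inj i = injT i \oc j i) -> wle w x%:Z (shift X) ->
  (forall q : hom X S, d \oc q = 0 -> J \oc q = 0 -> q = 0) /\
  (forall (s : hom X S) (u : hom X T), J \oc s = e \oc u ->
     exists u', s = d \oc u').
Proof.
elim: n v W V j k l phi S inj d J => [|n IHn] v W V j k l phi S inj d J
  xv dj Vge jphi cS cT hd he hJ Xle.
- rewrite addn0 in xv.
  have [K [G [H D]]] := dist_cone J.
  have [iV hV] := dependent_choice
    (fun i => dist_fill (dj i) D (esym (hJ i))).
  have cV := cone_coprod dj D cS cT hJ (fun i => (hV i).1) (fun i => (hV i).2).
  have Kge : wge w (x%:Z + 1) K.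
    rewrite -PoszD addn1; apply: (wge_leq xv).
    apply: (wge_coprod Hw countable_nat cV) => i.
    exact: wge_leq (leq_addr _ _) (Vge i).
  have Jinj (q : hom X S) : J \oc q = 0 -> q = 0.
    move=> /(dist_ker_f D)[z ez]; apply: shiftm_inj.
    by rewrite ez (wle_orth Xle Kge z) compm0 shiftm0.
  split=> [q _|s u Jse]; first exact: Jinj.
  have Xle' : wle w x%:Z X.
    by rewrite -(subrK 1 x%:Z); apply: wle_succ; rewrite -wle_shift subrK.
  have [u' eu] := dist_weak_ker D (wle_orth Xle' Kge (G \oc u)).
  exists u'; apply/eqP; rewrite -subr_eq0; apply/eqP/Jinj.
  have Jd : J \oc d = e \oc J.
    apply: (coprod_ext cS) => i; rewrite -[LHS]compmA -[RHS]compmA hd compBr.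
    by rewrite [J \oc (_ \oc _)]compmA !hJ -compmA jphi [RHS]compmA he compBl.
  by rewrite compBr compmA Jd -compmA -eu Jse subrr.
- have [S' [inj' cS']] := HC countable_nat (fun i => W i.+1).
  have [d' hd'] := coprod_mor (fun i => inj' i - inj' i.+1 \oc phi i.+1) cS'.
  have [J' hJ'] := coprod_mor (fun i => injT i \oc j i.+1) cS'.
  have [p hp] := coprod_mor (fun i => inj' i \oc phi i) cS.
  have [r hr] := coprod_mor (fun i => inj i.+1) cS'.
  have [] := IHn v.+1 (fun i => W i.+1) (fun i => V i.+1) (fun i => j i.+1)
    (fun i => k i.+1) (fun i => l i.+1) (fun i => phi i.+1) S' inj' d' J' => //.
  + by rewrite addSnnS.
  + by move=> i; rewrite addSnnS.
  move=> inj1 surj1.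
  have J'p : J' \oc p = J.
    by apply: (coprod_ext cS) => i; rewrite -compmA hp compmA hJ' hJ -compmA jphi.
  have rp : r \oc p = idm S - d.
    apply: (coprod_ext cS) => i.
    by rewrite -compmA hp compmA hr compBl comp1m hd opprB addrC subrK.
  have pd : p \oc d = d' \oc p.
    apply: (coprod_ext cS) => i.
    by rewrite -!compmA hp hd compBr hp !compmA hp hd' compBl.
  have rd : r \oc d' = d \oc r.
    apply: (coprod_ext cS') => i.
    by rewrite -!compmA hd' hr hd compBr hr compmA hr.
  split=> [q dq Jq|s u Jse].
    have -> : q = r \oc (p \oc q) by rewrite compmA rp compBl dq subr0 comp1m.
    by rewrite (inj1 (p \oc q)) ?compm0 // compmA ?J'p // -pd -compmA dq compm0.
  have [|u' eu'] := surj1 (p \oc s) u; first by rewrite compmA J'p.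
  exists (s + r \oc u').
  have: r \oc (p \oc s) = s - d \oc s by rewrite compmA rp compBl comp1m.
  by rewrite eu' compmA rd compDr -compmA => ->; rewrite addrC subrK.
Qed.

Lemma wle_factor (i : int) X L R (f : hom L M) (g : hom M R) (h : hom R (shift L)) :
  weight_decomposition w i f g h -> wle w i X ->
  forall a : hom X M, exists b, a = f \oc b.
Proof.
by move=> [d _ Rge] Xle a; apply: (dist_weak_ker d); exact: wle_orth Xle Rge _.
Qed.

(** Two lifts differ by a morphism that comes from the shifted back third vertex,
    which has weights at least [i + 1]. *)
Lemma weight_decomposition_lift_unique (i : nat) X L R (f : hom L M)
    (g : hom M R) (h : hom R (shift L)) :
  weight_decomposition w i.+1%:Z f g h -> wle w i%:Z X ->
  forall a : hom X M, exists! b, f \oc b = a.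
Proof.
move=> Wd Xle a.
have [b eb] := wle_factor Wd (wle_leq (leqnSn i) Xle) a.
exists b; split=> // b' eb'; apply/eqP; rewrite -subr_eq0; apply/eqP.
case: Wd => d _ Rge; have [|z ez] := dist_ker_f d (k := b - b').
  by rewrite compBr -eb eb' subrr.
apply: shiftm_inj; rewrite ez shiftm0 (@wle_orth _ w i.+1%:Z _ _ _ Rge z) ?compm0 //.
by rewrite -addn1 PoszD wle_shift.
Qed.

Lemma weight_tower_ex :
  exists (W V : nat -> C) (j : forall i, hom (W i) M) (k : forall i, hom M (V i))
    (l : forall i, hom (V i) (shift (W i))) (phi : forall i, hom (W i) (W i.+1)),
    (forall i : nat, weight_decomposition w i%:Z (j i) (k i) (l i)) /\
    (forall i, j i.+1 \oc phi i = j i).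
Proof.
have [W hW] := dependent_choice (fun n => weight_decomposition_ex w n M).
have {hW} [V hV] := dependent_choice hW.
have {hV} [j hj] := dependent_choice hV.
have {hj} [k hk] := dependent_choice hj.
have {hk} [l Wdec] := dependent_choice hk.
have Wle i : wle w i%:Z (W i) by case: (Wdec i).
have [phi hphi] := dependent_choice
  (fun i => weight_decomposition_lift_unique (Wdec i.+1) (Wle i) (j i)).
by exists W, V, j, k, l, phi; split=> // i; case: (hphi i).
Qed.

Section Hocolim.
Variables (W V : nat -> C) (j : forall i, hom (W i) M)
  (k : forall i, hom M (V i)) (l : forall i, hom (V i) (shift (W i)))
  (phi : forall i, hom (W i) (W i.+1)) (H : C).
Hypotheses (Wdec : forall i : nat, weight_decomposition w i%:Z (j i) (k i) (l i))
  (jphi : forall i, j i.+1 \oc phi i = j i).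

(** Every morphism from a bounded above object [X] to [M] lifts along [m], since
    it factors through some [W n]. If [m \oc f = 0] for [f : hom X H], then
    [telescope_orth] shows that the component of [f] in [shift S] vanishes and that
    the resulting lift of [f] to [S] comes from [d]; its hypotheses hold because the
    constant telescope on [M] is a split monomorphism [e] with cokernel [M]. *)
Lemma hocolim_cone_degenerate : is_hocolim phi H ->
  exists (N : C) (m : hom H M) (b : hom M N) (c : hom N (shift H)),
    dist m b c /\ left_degenerate w N.
Proof.
move=> [S [inj [d [g [h [cS hd D]]]]]].
have [tau htau] := coprod_mor j cS.
have [|m em] := dist_weak_coker (k := tau) D.
  apply: (coprod_ext cS) => i.
  by rewrite -compmA hd compBr compmA !htau jphi comp0m subrr.
have [N [b [c Dm]]] := dist_cone m.
exists N, m, b, c; split=> //.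
have [T [injT cT]] := HC countable_nat (fun _ => M).
have [e he] := coprod_mor (fun i => injT i - injT i.+1) cT.
have [J hJ] := coprod_mor (fun i => injT i \oc j i) cS.
have [t ht] := coprod_mor (fun _ => idm M) cT.
(* [r] retracts [e]: it sends a summand to minus the sum of the earlier ones. *)
pose rho := fix rho (i : nat) : hom M T :=
  if i is i'.+1 then rho i' - injT i' else 0.
have [r hr] := coprod_mor rho cT.
have re : r \oc e = idm T.
  apply: (coprod_ext cT) => i.
  by rewrite -compmA he compBr !hr comp1m /= opprB addrC subrK.
have er : e \oc r = idm T - injT 0%N \oc t.
  apply: (coprod_ext cT) => i.
  rewrite -compmA hr compBl comp1m -compmA ht compm1.
  elim: i => [|i IHi] /=; first by rewrite compm0 subrr.
  by rewrite compBr he IHi opprB addrC subrKA.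
have tJ : t \oc J = tau.
  by apply: (coprod_ext cS) => i; rewrite -compmA hJ compmA ht comp1m htau.
have Jd : J \oc d = e \oc J.
  apply: (coprod_ext cS) => i; rewrite -[LHS]compmA -[RHS]compmA hd compBr.
  by rewrite [J \oc (_ \oc _)]compmA !hJ -compmA jphi [RHS]compmA he compBl.
have orthX X : bounded_above w X ->
    (forall q : hom X S, d \oc q = 0 -> q = 0) /\
    (forall s : hom X S, tau \oc s = 0 -> exists u', s = d \oc u').
  move=> /bounded_above_shift /bounded_aboveP [x Xle].
  have dj i : dist (j i) (k i) (l i) by case: (Wdec i).
  have Vge i : wge w (1 + i)%N%:Z (V i).
    by case: (Wdec i) => _ _; rewrite addnC PoszD.
  have [inj1 surj1] :=
    telescope_orth (leqnn _ : (x < 1 + x)%N) dj Vge jphi cS cT hd he hJ Xle.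
  split=> [q dq|s ts]; first apply: inj1 => //.
    by rewrite -[LHS]comp1m -re -compmA [e \oc _]compmA -Jd -compmA dq !compm0.
  apply: (surj1 _ (r \oc (J \oc s))).
  by rewrite compmA er compBl comp1m -compmA [t \oc _]compmA tJ ts compm0 subr0.
have minj X (f : hom X H) : bounded_above w X -> m \oc f = 0 -> f = 0.
  move=> Xb mf; have [u [v [vu uv]]] := unshiftK X.
  have [q eq] := shiftm_full (h \oc f \oc u).
  have q0 : q = 0.
    apply: (orthX (unshift X) _).1.
      by apply: bounded_above_of_shift; apply: bounded_above_iso Xb; exists v, u.
    apply: shiftm_inj.
    by rewrite shiftmM -eq !compmA (dist_comp_sfh D) !comp0m shiftm0.
  have [|s es] := dist_ker_h D (k := f).
    by rewrite -[LHS]compm1 -uv compmA eq q0 shiftm0 comp0m.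
  have [|u' eu'] := (orthX X Xb).2 s; first by rewrite em -compmA -es.
  by rewrite es eu' compmA (dist_comp0 D) comp0m.
apply/left_degenerateP => n; apply: wge_succ; apply/wge_orthP => X Xle y.
have [u [v [vu uv]]] := unshiftK X.
have [z ez] := shiftm_full (c \oc y \oc u).
have z0 : z = 0.
  apply: minj.
    by apply: bounded_above_of_shift; exists n%:Z; apply: wle_iso Xle; exists v, u.
  by apply: shiftm_inj; rewrite shiftmM -ez !compmA (dist_comp_sfh Dm) !comp0m shiftm0.
have [|x ->] := dist_ker_h Dm (k := y).
  by rewrite -[LHS]compm1 -uv compmA ez z0 shiftm0 comp0m.
have [x' ->] := wle_factor (Wdec n) Xle x.
by rewrite -htau em -!compmA compmA (dist_comp0 Dm) comp0m.
Qed.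

End Hocolim.

Lemma hocolim_ex (Y : nat -> C) (phi : forall i, hom (Y i) (Y i.+1)) :
  exists H, is_hocolim phi H.
Proof.
have [S [inj cS]] := HC countable_nat Y.
have [d hd] := coprod_mor (fun i => inj i - inj i.+1 \oc phi i) cS.
have [H [g [h D]]] := dist_cone d.
by exists H, S, inj, d, g, h.
Qed.

Lemma hocolim_iso (Y : nat -> C) (phi : forall i, hom (Y i) (Y i.+1)) H H' :
  isomorphic H H' -> is_hocolim phi H -> is_hocolim phi H'.
Proof.
move=> [a [a' [a'a aa']]] [S [inj [d [g [h [cS hd D]]]]]].
exists S, inj, d, (a \oc g), (h \oc a'); split=> //.
apply: (dist_iso (a := idm S) (b := idm S) (c := a)) D;
  rewrite ?compm1 ?comp1m //; try exact: is_iso_id.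
  by exists a'.
by rewrite shiftm1 comp1m -compmA a'a compm1.
Qed.

(** A homotopy colimit of the [Y i] is an extension of coproducts of the [Y i]
    and of the [shift (Y i)]. *)
Lemma hocolim_almost_bounded_above (Y : nat -> C)
    (phi : forall i, hom (Y i) (Y i.+1)) H :
  (forall i, bounded_above w (Y i)) -> is_hocolim phi H ->
  almost_bounded_above w H.
Proof.
move=> Yb [S [inj [d [g [h [cS hd D]]]]]] Q Qext Qsm Qb.
have Q0 X : bounded_above w X -> Q X.
  move=> Xb; apply: (Qb 0); apply/shift_class0 => //.
  exact: bounded_above_iso.
have QS : Q S by apply: (Qsm _ countable_nat Y _).2 cS => i; exact: Q0.
apply: (Qext.2 _ _ _ _ _ _ ((dist_rot _ _ _).1 D) QS).
apply: (Qsm _ countable_nat (fun i => shift (Y i)) _).2 ((coprod_shift inj).1 cS).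
by move=> i; apply/Q0/bounded_above_shift.
Qed.

Lemma hocolim_wge0 (Y : nat -> C) (phi : forall i, hom (Y i) (Y i.+1)) H :
  (forall i, wge0 w (Y i)) -> is_hocolim phi H -> wge0 w H.
Proof.
move=> Yge [S [inj [d [g [h [cS hd D]]]]]]; apply/wge0E.
have Sge : wge w 0 S.
  by apply: (wge_coprod Hw countable_nat cS) => i; apply/wge0E.
apply: (wge_ext ((dist_rot _ _ _).1 D) Sge).
by apply: wge_succ; rewrite wge_shift.
Qed.

End Telescope.

(** * Coreflections and reflections in triangulated subcategories *)

Definition coreflection (C : preadditive) (P : C -> Prop) (K Z : C)
    (a : hom K Z) : Prop :=
  P K /\ forall A : C, P A -> forall f : hom A Z, exists! u, a \oc u = f.

Definition reflection (C : preadditive) (Q : C -> Prop) (Z K : C)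
    (b : hom Z K) : Prop :=
  Q K /\ forall B : C, Q B -> forall f : hom Z B, exists! u, u \oc b = f.

Section Reflections.
Variable C : preadditive.
Implicit Types (P Q : C -> Prop) (A B K Z : C).

Lemma coreflection_lift P K Z (a : hom K Z) A (f : hom A Z) :
  coreflection P a -> P A -> exists u, a \oc u = f.
Proof. by move=> [_ ca] PA; have [u [hu _]] := ca A PA f; exists u. Qed.

Lemma coreflection_inj P K Z (a : hom K Z) A (u u' : hom A K) :
  coreflection P a -> P A -> a \oc u = a \oc u' -> u = u'.
Proof.
move=> [_ ca] PA e; have [v [_ hv]] := ca A PA (a \oc u').
by rewrite -(hv u e) -(hv u').
Qed.

Lemma reflection_lift Q K Z (b : hom Z K) B (f : hom Z B) :
  reflection Q b -> Q B -> exists u, u \oc b = f.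
Proof. by move=> [_ cb] QB; have [u [hu _]] := cb B QB f; exists u. Qed.

Lemma reflection_inj Q K Z (b : hom Z K) B (u u' : hom K B) :
  reflection Q b -> Q B -> u \oc b = u' \oc b -> u = u'.
Proof.
move=> [_ cb] QB e; have [v [_ hv]] := cb B QB (u' \oc b).
by rewrite -(hv u e) -(hv u').
Qed.

Lemma coreflectionI P K Z (a : hom K Z) : P K ->
  (forall A, P A -> forall f : hom A Z, exists u, a \oc u = f) ->
  (forall A, P A -> forall u : hom A K, a \oc u = 0 -> u = 0) ->
  coreflection P a.
Proof.
move=> PK ex un; split=> // A PA f; have [u hu] := ex A PA f; exists u.
split=> // u' hu'; apply/eqP; rewrite -subr_eq0; apply/eqP/un => //.
by rewrite compBr hu hu' subrr.
Qed.

Lemma reflectionI Q K Z (b : hom Z K) : Q K ->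
  (forall B, Q B -> forall f : hom Z B, exists u, u \oc b = f) ->
  (forall B, Q B -> forall u : hom K B, u \oc b = 0 -> u = 0) ->
  reflection Q b.
Proof.
move=> QK ex un; split=> // B QB f; have [u hu] := ex B QB f; exists u.
split=> // u' hu'; apply/eqP; rewrite -subr_eq0; apply/eqP/un => //.
by rewrite compBl hu hu' subrr.
Qed.

Lemma coreflection_iso P K K' Z (a : hom K Z) (a' : hom K' Z) :
  coreflection P a -> coreflection P a' -> exists u, is_iso u /\ a \oc u = a'.
Proof.
move=> ca ca'; have [u eu] := coreflection_lift a' ca ca'.1.
have [v ev] := coreflection_lift a ca' ca.1.
exists u; split=> //; exists v; split.
  by apply: (coreflection_inj ca' ca'.1); rewrite compmA ev eu compm1.
by apply: (coreflection_inj ca ca.1); rewrite compmA eu ev compm1.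
Qed.

Lemma reflection_iso Q K K' Z (b : hom Z K) (b' : hom Z K') :
  reflection Q b -> reflection Q b' -> exists u, is_iso u /\ u \oc b = b'.
Proof.
move=> cb cb'; have [u eu] := reflection_lift b' cb cb'.1.
have [v ev] := reflection_lift b cb' cb.1.
exists u; split=> //; exists v; split.
  by apply: (reflection_inj cb cb.1); rewrite -compmA eu ev comp1m.
by apply: (reflection_inj cb' cb'.1); rewrite -compmA ev eu comp1m.
Qed.

End Reflections.

Section ReflectionTriangles.
Variable C : triangulated.

Lemma coreflection_shift (P : C -> Prop) K Z (a : hom K Z) :
  triangulated_sub P -> coreflection P a -> coreflection P (shiftm a).
Proof.
move=> HP ca; apply: coreflectionI => [|A PA f|A PA u];
  first exact: (tsub_shift HP ca.1).
- have [i [r [ri ir]]] := unshiftK A.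
  have [g eg] := shiftm_full (f \oc i).
  have [u eu] := coreflection_lift g ca (tsub_unshift HP PA).
  by exists (shiftm u \oc r); rewrite compmA -shiftmM eu -eg -compmA ir compm1.
- have [i [r [ri ir]]] := unshiftK A; have [g eg] := shiftm_full (u \oc i) => au.
  suff g0 : g = 0 by rewrite -[u]compm1 -ir compmA eg g0 shiftm0 comp0m.
  apply: (coreflection_inj ca (tsub_unshift HP PA)); apply: shiftm_inj.
  by rewrite shiftmM -eg compmA au compm0 shiftm0 comp0m.
Qed.

Lemma reflection_shift (Q : C -> Prop) K Z (b : hom Z K) :
  triangulated_sub Q -> reflection Q b -> reflection Q (shiftm b).
Proof.
move=> HQ cb; apply: reflectionI => [|B QB f|B QB u];
  first exact: (tsub_shift HQ cb.1).
- have [i [r [ri ir]]] := unshiftK B.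
  have [g eg] := shiftm_full (r \oc f).
  have [u eu] := reflection_lift g cb (tsub_unshift HQ QB).
  by exists (i \oc shiftm u); rewrite -compmA -shiftmM eu -eg compmA ir comp1m.
- have [i [r [ri ir]]] := unshiftK B; have [g eg] := shiftm_full (r \oc u) => ub.
  suff g0 : g = 0 by rewrite -[u]comp1m -ir -compmA eg g0 shiftm0 compm0.
  apply: (reflection_inj cb (tsub_unshift HQ QB)); apply: shiftm_inj.
  by rewrite shiftmM -eg -compmA ub compm0 comp0m shiftm0.
Qed.

Section Cones.
Variables (X Y Z : C) (f : hom X Y) (g : hom Y Z) (h : hom Z (shift X)).
Variables (X' Y' Z' : C) (f' : hom X' Y') (g' : hom Y' Z') (h' : hom Z' (shift X')).
Hypotheses (D : dist f g h) (D' : dist f' g' h').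

(** The five lemma for [Hom(A, -)] with [A] in [P]: a morphism of triangles
    that is a coreflection at two vertices is one at the third. *)
Lemma coreflection_cone (P : C -> Prop) (a : hom X' X) (b : hom Y' Y) (c : hom Z' Z) :
  triangulated_sub P -> coreflection P a -> coreflection P b ->
  b \oc f' = f \oc a -> c \oc g' = g \oc b -> shiftm a \oc h' = h \oc c ->
  coreflection P c.
Proof.
move=> HP ca cb ef eg eh; have ca1 := coreflection_shift HP ca.
have cb1 := coreflection_shift HP cb.
apply: coreflectionI => [|A PA z|A PA u cu]; first exact: (tsub_cone HP D' ca.1 cb.1).
- have [x ex] := coreflection_lift (h \oc z) ca1 PA.
  have [|v ev] := dist_ker_sf D' (k := x).
    apply: (coreflection_inj cb1 PA).
    rewrite compmA -shiftmM ef shiftmM -compmA ex compmA (dist_comp_sfh D).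
    by rewrite comp0m compm0.
  have [|y ey] := dist_ker_h D (k := z - c \oc v).
    by rewrite compBr [h \oc (c \oc v)]compmA -eh -compmA -ev ex subrr.
  have [y' ey'] := coreflection_lift y cb PA.
  exists (v + g' \oc y').
  by rewrite compDr [c \oc (_ \oc _)]compmA eg -compmA ey' -ey addrC subrK.
- have [|w ew] := dist_ker_h D' (k := u).
    apply: (coreflection_inj ca1 PA).
    by rewrite compmA eh -compmA cu !compm0.
  have [|x ex] := dist_weak_ker D (k := b \oc w).
    by rewrite compmA -eg -compmA -ew.
  have [x' ex'] := coreflection_lift x ca PA.
  have -> : u = g' \oc (f' \oc x').
    rewrite ew; congr (_ \oc _); apply: (coreflection_inj cb PA).
    by rewrite ex -ex' !compmA ef.
  by rewrite compmA (dist_comp0 D') comp0m.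
Qed.

(** The same for [Hom(-, B)] with [B] in [Q]. *)
Lemma reflection_cone (Q : C -> Prop) (a : hom X X') (b : hom Y Y') (c : hom Z Z') :
  triangulated_sub Q -> reflection Q a -> reflection Q b ->
  b \oc f = f' \oc a -> c \oc g = g' \oc b -> shiftm a \oc h = h' \oc c ->
  reflection Q c.
Proof.
move=> HQ ca cb ef eg eh; have ca1 := reflection_shift HQ ca.
have cb1 := reflection_shift HQ cb.
apply: reflectionI => [|B QB z|B QB v vc]; first exact: (tsub_cone HQ D' ca.1 cb.1).
- have [y ey] := reflection_lift (z \oc g) cb QB.
  have [|v ev] := dist_weak_coker D' (k := y).
    apply: (reflection_inj ca QB).
    by rewrite -compmA -ef compmA ey -compmA (dist_comp0 D) compm0 comp0m.
  have [|x ex] := dist_coker_g D (k := z - v \oc c).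
    by rewrite compBl -[v \oc c \oc g]compmA eg compmA -ev ey subrr.
  have [x' ex'] := reflection_lift x ca1 QB.
  exists (v + x' \oc h').
  by rewrite compDl -[x' \oc _ \oc _]compmA -eh compmA ex' -ex addrC subrK.
- have [|x ex] := dist_coker_g D' (k := v).
    apply: (reflection_inj cb QB).
    by rewrite -compmA -eg compmA vc !comp0m.
  have [|y ey] := dist_coker_h D (k := x \oc shiftm a).
    by rewrite -compmA eh compmA -ex.
  have [y' ey'] := reflection_lift y cb1 QB.
  have -> : v = y' \oc shiftm f' \oc h'.
    rewrite ex; congr (_ \oc _); apply: (reflection_inj ca1 QB).
    by rewrite ey -ey' -!compmA -!shiftmM ef.
  by rewrite -compmA (dist_comp_sfh D') compm0.
Qed.

End Cones.
End ReflectionTriangles.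

Section Coreflector.
Variables (C : triangulated) (P : C -> Prop) (HP : triangulated_sub P).
Variables (R : C -> C) (a : forall M, hom (R M) M).
Hypothesis ca : forall M, coreflection P (a M).

Definition coreflect_mor M N (f : hom M N) : hom (R M) (R N) :=
  sval (cid (coreflection_lift (f \oc a M) (ca N) (ca M).1)).

Lemma coreflect_morE M N (f : hom M N) : a N \oc coreflect_mor f = f \oc a M.
Proof. by rewrite /coreflect_mor; case: cid. Qed.

Lemma coreflect_mor_unique M N (f : hom M N) (u : hom (R M) (R N)) :
  a N \oc u = f \oc a M -> u = coreflect_mor f.
Proof.
by move=> eu; apply: (coreflection_inj (ca N) (ca M).1); rewrite coreflect_morE.
Qed.

Lemma coreflect_mor1 M : coreflect_mor (idm M) = idm (R M).
Proof. symmetry; apply: coreflect_mor_unique.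
by rewrite compm1 comp1m. Qed.

Lemma coreflect_morM M N K (g : hom N K) (f : hom M N) :
  coreflect_mor (g \oc f) = coreflect_mor g \oc coreflect_mor f.
Proof.
symmetry; apply: coreflect_mor_unique.
by rewrite compmA coreflect_morE -compmA coreflect_morE compmA.
Qed.

Definition coreflector : functor C (full_sub HP) := {|
  fobj := fun M => exist P (R M) (ca M).1 : full_sub HP;
  fmap := fun M N f => coreflect_mor f;
  fmap1 := coreflect_mor1;
  fmapM := coreflect_morM
|}.

Lemma coreflector_adjoint : adjoint (incl HP) coreflector.
Proof.
pose phi (X : full_sub HP) (Y : C) (f : hom (incl HP X) Y) : hom X (coreflector Y) :=
  sval (cid (coreflection_lift f (ca Y) (svalP X))).
have phiE X Y (f : hom (incl HP X) Y) : a Y \oc phi X Y f = f.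
  by rewrite /phi; case: cid.
exists phi; split=> [X Y|X X' Y Y' u b f].
  exists (fun g => a Y \oc g) => [f|g]; first exact: phiE.
  by apply: (coreflection_inj (ca Y) (svalP X)); rewrite phiE.
apply: (coreflection_inj (ca Y') (svalP X')); rewrite phiE.
rewrite [fmap coreflector b]/(coreflect_mor b).
by rewrite [RHS]compmA [in RHS]compmA coreflect_morE -[in RHS](compmA b) phiE.
Qed.

(** The cone of the coreflection of [f] is by [coreflection_cone] a coreflection of
    the cone of [f], hence isomorphic to the chosen one. *)
Lemma coreflector_exact : exact coreflector.
Proof.
split=> [X Y f g|].
  symmetry; apply: coreflect_mor_unique.
by rewrite compDr compDl !coreflect_morE.
have [th hth] := dependent_choice
  (fun X => coreflection_iso (coreflection_shift HP (ca X)) (ca (shift X))).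
exists th; split=> [X|X Y f|X Y Z f g h D].
- exact: (hth X).1.
- apply: (coreflection_inj (coreflection_shift HP (ca Y)) (ca (shift X)).1).
  rewrite [LHS]compmA (hth Y).2 [LHS]coreflect_morE [RHS]compmA -shiftmM coreflect_morE.
  by rewrite shiftmM -compmA (hth X).2.
have [K [g' [h' D']]] := dist_cone (coreflect_mor f).
have [c [cg hc]] := dist_fill D' D (coreflect_morE f).
have cc := coreflection_cone D D' HP (ca X) (ca Y) (coreflect_morE f) cg hc.
have [u [ui eu]] := coreflection_iso (ca Z) cc.
apply: (dist_iso (a := idm (R X)) (b := idm (R Y)) (c := u)) D';
  rewrite ?comp1m ?compm1 //; try exact: is_iso_id.
  by apply: coreflect_mor_unique; rewrite compmA eu.
rewrite shiftm1 comp1m.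
apply: (coreflection_inj (coreflection_shift HP (ca X)) cc.1).
rewrite hc -[in RHS]compmA [RHS]compmA (hth X).2 [RHS]compmA.
by rewrite [X in _ = X \oc u]coreflect_morE -compmA eu.
Qed.

End Coreflector.

Section Reflector.
Variables (C : triangulated) (Q : C -> Prop) (HQ : triangulated_sub Q).
Variables (L : C -> C) (b : forall M, hom M (L M)).
Hypothesis cb : forall M, reflection Q (b M).

Definition reflect_mor M N (f : hom M N) : hom (L M) (L N) :=
  sval (cid (reflection_lift (b N \oc f) (cb M) (cb N).1)).

Lemma reflect_morE M N (f : hom M N) : reflect_mor f \oc b M = b N \oc f.
Proof. by rewrite /reflect_mor; case: cid. Qed.

Lemma reflect_mor_unique M N (f : hom M N) (u : hom (L M) (L N)) :
  u \oc b M = b N \oc f -> u = reflect_mor f.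
Proof. by move=> eu; apply: (reflection_inj (cb M) (cb N).1); rewrite reflect_morE. Qed.

Lemma reflect_mor1 M : reflect_mor (idm M) = idm (L M).
Proof. symmetry; apply: reflect_mor_unique.
by rewrite compm1 comp1m. Qed.

Lemma reflect_morM M N K (g : hom N K) (f : hom M N) :
  reflect_mor (g \oc f) = reflect_mor g \oc reflect_mor f.
Proof.
symmetry; apply: reflect_mor_unique.
by rewrite -compmA reflect_morE compmA reflect_morE compmA.
Qed.

Definition reflector : functor C (full_sub HQ) := {|
  fobj := fun M => exist Q (L M) (cb M).1 : full_sub HQ;
  fmap := fun M N f => reflect_mor f;
  fmap1 := reflect_mor1;
  fmapM := reflect_morM
|}.

Lemma reflector_adjoint : adjoint reflector (incl HQ).
Proof.
exists (fun X Y f => f \oc b X); split=> [X Y|X X' Y Y' u c f].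
  have inv (g : hom X (incl HQ Y)) := cid (reflection_lift g (cb X) (svalP Y)).
  exists (fun g => sval (inv g)) => [f|g]; last exact: (svalP (inv g)).
  by apply: (reflection_inj (cb X) (svalP Y)); exact: (svalP (inv _)).
pose c' : hom (sval Y) (sval Y') := c; pose f' : hom (L X) (sval Y) := f.
change (c' \oc f' \oc reflect_mor u \oc b X' = c' \oc (f' \oc b X) \oc u).
by rewrite -[LHS]compmA reflect_morE -!compmA.
Qed.

Lemma reflector_exact : exact reflector.
Proof.
split=> [X Y f g|].
  symmetry; apply: reflect_mor_unique.
by rewrite compDr compDl !reflect_morE.
have [th hth] := dependent_choice
  (fun X => reflection_iso (cb (shift X)) (reflection_shift HQ (cb X))).
exists th; split=> [X|X Y f|X Y Z f g h D].
- exact: (hth X).1.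
- apply: (reflection_inj (cb (shift X)) (tsub_shift HQ (cb Y).1)).
  rewrite -[LHS]compmA [X in _ \oc X = _]reflect_morE [LHS]compmA (hth Y).2.
  by rewrite -[RHS]compmA (hth X).2 -!shiftmM reflect_morE.
have [K [g' [h' D']]] := dist_cone (reflect_mor f).
have [c [cg hc]] := dist_fill D D' (esym (reflect_morE f)).
have cc := reflection_cone D D' HQ (cb X) (cb Y) (esym (reflect_morE f)) cg hc.
have [u [ui eu]] := reflection_iso cc (cb Z).
apply: (dist_iso (a := idm (L X)) (b := idm (L Y)) (c := u)) D';
  rewrite ?comp1m ?compm1 //; try exact: is_iso_id.
  by apply: reflect_mor_unique; rewrite -compmA -cg compmA eu.
rewrite shiftm1 comp1m.
apply: (reflection_inj cc (tsub_shift HQ (cb X).1)).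
rewrite -hc -[RHS]compmA eu -[RHS]compmA [X in _ = _ \oc X]reflect_morE.
by rewrite compmA (hth X).2.
Qed.

End Reflector.

Section SemiorthogonalPair.
Variables (C : triangulated) (P Q : C -> Prop).
Hypotheses (HP : triangulated_sub P) (HQ : triangulated_sub Q)
  (orth : forall X, P X -> left_orth Q X).
Variables (M K N : C) (a : hom K M) (b : hom M N) (c : hom N (shift K)).
Hypotheses (D : dist a b c) (PK : P K) (QN : Q N).

Lemma semiorthogonal_coreflection : coreflection P a.
Proof.
apply: coreflectionI => // A PA f.
  have [u ->] := dist_weak_ker D (orth PA QN (b \oc f)).
  by exists u.
move=> /(dist_ker_f D)[l el]; apply: shiftm_inj.
by rewrite el (orth (tsub_shift HP PA) QN l) compm0 shiftm0.
Qed.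

Lemma semiorthogonal_reflection : reflection Q b.
Proof.
apply: reflectionI => // B QB f.
  have [u ->] := dist_weak_coker D (orth PK QB (f \oc a)).
  by exists u.
move=> /(dist_coker_g D)[l ->].
by rewrite (orth (tsub_shift HP PK) QB l) comp0m.
Qed.

End SemiorthogonalPair.

(** * The semiorthogonal decomposition *)

Lemma left_orth_sub (C : triangulated) (Q : C -> Prop) :
  triangulated_sub Q -> triangulated_sub (left_orth Q).
Proof.
move=> HQ.
have oshift X : left_orth Q X -> left_orth Q (shift X).
  move=> oX N QN f; have [i [r [ri ir]]] := unshiftK N.
  have [g eg] := shiftm_full (r \oc f).
  by rewrite -[f]comp1m -ir -compmA eg (oX _ (tsub_unshift HQ QN) g) shiftm0 compm0.
split=> // [Z zZ N _|X oX N QN f|X Y Z f g h D oX oY].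
- exact: (zZ N).2.
- apply: shiftm_inj; rewrite shiftm0.
  have oX' := left_orth_iso_closed (isomorphic_sym (unshiftK X)) oX.
  exact: oX' (tsub_shift HQ QN) _.
- exact: (left_orth_ext ((dist_rot _ _ _).1 D) oY (oshift X oX)).
Qed.

Section SemiorthogonalReflections.
Variables (C : triangulated) (P Q : C -> Prop).
Hypotheses (HP : triangulated_sub P) (HQ : triangulated_sub Q)
  (orth : forall X, P X -> left_orth Q X).

(** The two universal properties force both morphisms; completing the one between
    the first vertices and the identity of [M] to a map of triangles shows that they
    are compatible with the third edges. *)
Lemma semiorthogonal_triangle_unique M K N A B
    (a : hom K M) (b : hom M N) (c : hom N (shift K))
    (f : hom A M) (g : hom M B) (h : hom B (shift A)) :
  dist a b c -> P K -> Q N -> dist f g h -> P A -> Q B ->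
  exists! uv : hom A K * hom B N,
    [/\ is_iso uv.1, is_iso uv.2, a \oc uv.1 = f, uv.2 \oc g = b
      & shiftm uv.1 \oc h = c \oc uv.2].
Proof.
move=> D PK QN D' PA QB.
have ca := semiorthogonal_coreflection HP orth D PK QN.
have cf := semiorthogonal_coreflection HP orth D' PA QB.
have cb := semiorthogonal_reflection HP orth D PK QN.
have cg := semiorthogonal_reflection HP orth D' PA QB.
have [u [ui eu]] := coreflection_iso ca cf.
have [|v [vg hv]] := dist_fill (a := u) (b := idm M) D' D; first by rewrite comp1m.
have [v' [v'i ev']] := reflection_iso cg cb.
rewrite compm1 in vg.
exists (u, v); split=> [|[u' v'' /= [_ _ eu' ev'' _]]].
  split=> //=; suff -> : v = v' by [].
  by apply: (reflection_inj cg QN); rewrite vg.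
congr (_, _); first by apply: (coreflection_inj ca PA); rewrite eu.
by apply: (reflection_inj cg QN); rewrite vg.
Qed.

Variables (R L : C -> C) (a : forall M, hom (R M) M) (b : forall M, hom M (L M))
  (c : forall M, hom (L M) (shift (R M))).
Hypotheses (D : forall M, dist (a M) (b M) (c M))
  (ca : forall M, coreflection P (a M)) (cb : forall M, reflection Q (b M)).

(** A morphism that completes a map of triangles must be [reflect_mor cb f], as it
    is determined by its composite with the reflection. *)
Lemma connecting_natural M N (f : hom M N) :
  shiftm (coreflect_mor ca f) \oc c M = c N \oc reflect_mor cb f.
Proof.
have [v [ev hv]] := dist_fill (D M) (D N) (esym (coreflect_morE ca f)).
by rewrite hv (reflect_mor_unique cb ev).
Qed.

(** The coproduct in [C] of the [L (X i)] lies in [Q], hence it is the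
    reflection of the coproduct [S]. So the triangles of the [X i] and of [S]
    identify [shift (R S)] with the cone of a coproduct of morphisms. *)
Lemma coreflect_coprod (small : Type -> Prop) I (X : I -> C) S
    (inj : forall i, hom (X i) S) :
  smashing small Q -> small I -> is_coproduct inj ->
  is_coproduct (fun i => coreflect_mor ca (inj i)).
Proof.
move=> smQ sI cS.
have QL i : Q (L (X i)) by exact: (cb (X i)).1.
have [[T [injT cT]] QT] := smQ I sI (fun i => L (X i)) QL.
have {}QT := QT _ _ cT.
have [r hr] := coprod_mor (fun i => injT i \oc b (X i)) cS.
have cr : reflection Q r.
  apply: reflectionI => // B QB f.
    have [u hu] := dependent_choice
      (fun i => reflection_lift (f \oc inj i) (cb (X i)) QB).
    have [u' hu'] := coprod_mor u cT; exists u'.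
    by apply: (coprod_ext cS) => i; rewrite -compmA hr compmA hu' hu.
  move=> fr; apply: (coprod_ext cT) => i; apply: (reflection_inj (cb (X i)) QB).
  by rewrite -compmA -hr compmA fr !comp0m.
have [v [vi ev]] := reflection_iso cr (cb S).
have cL : is_coproduct (fun i => reflect_mor cb (inj i)).
  apply: eq_coprod (coprod_iso cT vi) => i; apply: reflect_mor_unique.
  by rewrite -compmA -hr compmA ev.
apply/coprod_shift.
apply: (cone_coprod (fun i => (dist_rot _ _ _).1 (D (X i))) ((dist_rot _ _ _).1 (D S))
  cS cL) => i.
- by rewrite reflect_morE.
- exact: connecting_natural.
- by rewrite compNr compNl -!shiftmM coreflect_morE.
Qed.

End SemiorthogonalReflections.

(** A weight decomposition in [C] of an object of the subcategory lies in the
    subcategory, which contains two of its three vertices. *)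
Lemma restricts_of_le (C : triangulated) (w : weight_structure C)
    (P : C -> Prop) (HP : triangulated_sub P) :
  (forall X, wle0 w X -> P X) -> restricts w HP.
Proof.
move=> leP; have wax := weight_axiomsP w.
split.
- by move=> X Y XY; exact: (w_retract_le wax XY).
- by move=> X Y XY; exact: (w_retract_ge wax XY).
- move=> X /(w_shift_le wax)[Y [Yle XY]].
  by exists (exist P Y (leP Y Yle) : full_sub HP).
- by move=> X [Y [Yge XY]]; apply: (w_shift_ge wax); exists (sval Y).
- move=> X Y Xle [Z [Zge YZ]] f.
  by apply: (w_orth wax Xle) f; exists (sval Z).
- move=> [M PM]; have [L [N [f [g [h [D Lle [Y [Yge NY]]]]]]]] := w_dec wax M.
  have PN := tsub_cone HP D (leP L Lle) PM.
  have PY : P Y by apply: (tsub_of_shift HP); exact: (tsub_iso HP NY PN).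
  exists (exist P L (leP L Lle)), (exist P N PN), f, g, h; split=> //.
  by exists (exist P Y PY : full_sub HP).
Qed.

Section AlmostBoundedAbove.
Variables (C : triangulated) (w : weight_structure C).
Hypotheses (HC : has_coproducts C countable_type)
  (Hw : smashing countable_type (wge0 w)).

(** The first vertex is the homotopy colimit of a tower of weight truncations. *)
Lemma almost_bounded_above_decomposition M :
  exists (K N : C) (a : hom K M) (b : hom M N) (c : hom N (shift K)),
    [/\ dist a b c, almost_bounded_above w K & left_degenerate w N].
Proof.
have [W [V [j [k [l [phi [Wdec hphi]]]]]]] := weight_tower_ex w M.
have [H hH] := hocolim_ex HC phi.
have [N [m [b [c [D dN]]]]] :=
  hocolim_cone_degenerate HC Hw Wdec hphi hH.
exists H, N, m, b, c; split=> //; apply: hocolim_almost_bounded_above hH => i.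
by exists i%:Z; case: (Wdec i).
Qed.

(** If [M] is left orthogonal to the left degenerate objects, so is the third
    vertex [N] of its decomposition; being left degenerate itself, [N] is zero. *)
Lemma almost_bounded_aboveE M :
  almost_bounded_above w M <-> left_orth (left_degenerate w) M.
Proof.
split=> [|oM]; first exact: almost_bounded_above_orth.
have [K [N [a [b [c [D PK QN]]]]]] := almost_bounded_above_decomposition M.
have oN : left_orth (left_degenerate w) N.
  have HB := left_orth_sub (left_degenerate_sub w).
  by apply: (tsub_cone HB D _ oM); exact: almost_bounded_above_orth.
have ai : isomorphic K M.
  by exists a; apply: (dist_third_zero_iso D); apply/is_zeroP; exact: oN QN _.
move=> Q' Qext Qsm Qb; apply: (ext_closed_iso Qext ai); exact: PK.
Qed.

Lemma almost_bounded_above_sub : triangulated_sub (almost_bounded_above w).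
Proof.
have -> : almost_bounded_above w = left_orth (left_degenerate w).
  by apply/funext => M; apply/propext; exact: almost_bounded_aboveE.
exact: left_orth_sub (left_degenerate_sub w).
Qed.

Lemma wle0_almost_bounded_above M : wle0 w M -> almost_bounded_above w M.
Proof. by move=> Mle; apply: bounded_above_almost; exists 0; apply/wle0E. Qed.

End AlmostBoundedAbove.

Theorem theorem4p1p3 (C : triangulated) (HC : has_coproducts C countable_type)
    (w : weight_structure C) (Hw : ws_smashing w countable_type)
    (alpha : Type) (Halpha : infinite_regular alpha) :
  exists (Ha : triangulated_sub (almost_bounded_above w))
         (Hinf : triangulated_sub (left_degenerate w))
         (Hres : restricts w Ha)
         (R : functor C (full_sub Ha)) (L : functor C (full_sub Hinf)),
  let wa := restriction Hres in
  let small_alpha := fun I : Type => card_lt I alpha in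
  (* (1) *)
  ([/\ exact R,
       adjoint (incl Ha) R,
       forall M : C, is_zero (R M) <-> left_degenerate w M,
       exact L
     & adjoint L (incl Hinf)] /\
   (forall M : C,
     exists (a : hom (incl Ha (R M)) M) (b : hom M (incl Hinf (L M)))
            (c : hom (incl Hinf (L M)) (shift (incl Ha (R M)))),
       dist a b c /\
       forall (A B : C) (f : hom A M) (g : hom M B) (h : hom B (shift A)),
         dist f g h -> almost_bounded_above w A -> left_degenerate w B ->
         exists! uv : hom A (incl Ha (R M)) * hom B (incl Hinf (L M)),
           [/\ is_iso uv.1, is_iso uv.2, a \oc uv.1 = f, uv.2 \oc g = b
             & shiftm uv.1 \oc h = c \oc uv.2])) /\
  (* (2) *)
  (forall (M : C) (W V : nat -> C) (j : forall i, hom (W i) M)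
      (k : forall i, hom M (V i)) (l : forall i, hom (V i) (shift (W i))),
    (forall i : nat, weight_decomposition w i%:Z (j i) (k i) (l i)) ->
    (forall i : nat, exists! phi : hom (W i) (W i.+1), j i.+1 \oc phi = j i) /\
    (forall phi : (forall i : nat, hom (W i) (W i.+1)),
      (forall i : nat, j i.+1 \oc phi i = j i) ->
      (exists H : C, is_hocolim phi H) /\
      (forall H : C, is_hocolim phi H -> isomorphic (incl Ha (R M)) H))) /\
  (* (3) *)
  ((forall M : C,
     almost_bounded_above w M <-> left_orth (left_degenerate w) M) /\
   (has_coproducts C small_alpha ->
     smashing small_alpha (almost_bounded_above w))) /\
  (* (4) *)
  [/\ forall M : C, in_ambient (wle0 wa) M <-> wle0 w M,
      forall M : C, wge0 w M <->
        exists (A B : C) (f : hom A M) (g : hom M B) (h : hom B (shift A)),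
          [/\ dist f g h, in_ambient (wge0 wa) A & left_degenerate w B]
    & weight_exact w wa R] /\
  (* (5) *)
  (forall M : C, in_ambient (wge0 wa) M <->
    exists (Y : nat -> C) (phi : forall i : nat, hom (Y i) (Y i.+1)),
      (forall i : nat, bounded_above w (Y i) /\ wge0 w (Y i)) /\
      is_hocolim phi M) /\
  (* (6) *)
  ((smashing small_alpha (left_degenerate w) ->
     preserves_coproducts small_alpha R) /\
   (ws_smashing w small_alpha -> smashing small_alpha (left_degenerate w))).
Proof.
have smw := Hw.2; pose Aba := almost_bounded_above w; pose Ldeg := left_degenerate w.
have Ha : triangulated_sub (almost_bounded_above w).
  exact: almost_bounded_above_sub.
have Hinf := left_degenerate_sub w.
have orth X : Aba X -> left_orth Ldeg X by exact: almost_bounded_above_orth.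
have leA X : wle0 w X -> Aba X by exact: wle0_almost_bounded_above.
have [R0 hR] := dependent_choice (almost_bounded_above_decomposition HC smw).
have {hR} [L0 hL] := dependent_choice hR.
have {hL} [a ha] := dependent_choice hL.
have {ha} [b hb] := dependent_choice ha.
have {hb} [c hc] := dependent_choice hb.
have D M : dist (a M) (b M) (c M) by case: (hc M).
have PR M : Aba (R0 M) by case: (hc M).
have QL M : Ldeg (L0 M) by case: (hc M).
have ca M := semiorthogonal_coreflection Ha orth (D M) (PR M) (QL M).
have cb M := semiorthogonal_reflection Ha orth (D M) (PR M) (QL M).
(* [R0 M] is an extension of [M] by [L0 M] shifted back, still left degenerate. *)
have wgeR M : wge0 w M -> wge0 w (R0 M).
  move=> /wge0E Mge; apply/wge0E; rewrite -wge_shift.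
  apply: (wge_ext ((dist_rot _ _ _).1 ((dist_rot _ _ _).1 (D M))) (QL M _)).
  by rewrite wge_shift.
have isoR M : Aba M -> isomorphic (R0 M) M.
  move=> PM; exists (a M); apply: (dist_third_zero_iso (D M)); apply/is_zeroP.
  exact: (orth _ (tsub_cone Ha (D M) (PR M) PM) _ (QL M)).
exists Ha, Hinf, (restricts_of_le Ha leA), (coreflector Ha ca), (reflector Hinf cb).
move=> wa small_alpha.
have ambient_le M : in_ambient (wle0 wa) M <-> wle0 w M.
  split=> [[X [Xle <-]] //|Mle].
  by exists (exist _ M (leA M Mle) : full_sub Ha).
have ambient_ge M : in_ambient (wge0 wa) M <-> Aba M /\ wge0 w M.
  split=> [[X [Xge <-]]|[PM Mge]]; first by split; first exact: (svalP X).
  by exists (exist _ M PM : full_sub Ha).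
have exR := coreflector_exact Ha ca.
have hocolimR M (W V : nat -> C) (j : forall i, hom (W i) M)
    (k : forall i, hom M (V i)) (l : forall i, hom (V i) (shift (W i))) phi H :
    (forall i : nat, weight_decomposition w i%:Z (j i) (k i) (l i)) ->
    (forall i : nat, j i.+1 \oc phi i = j i) -> is_hocolim phi H ->
    isomorphic (R0 M) H.
  move=> Wdec hphi hH.
  have [N [m [b' [c' [Dm dN]]]]] := hocolim_cone_degenerate HC smw Wdec hphi hH.
  have AH : Aba H.
    by apply: hocolim_almost_bounded_above hH => i; exists i%:Z; case: (Wdec i).
  have cm := semiorthogonal_coreflection Ha orth Dm AH dN.
  by have [u [ui _]] := coreflection_iso cm (ca M); exists u.
split.
  split.
    split; [exact: exR | exact: coreflector_adjoint | | exact: reflector_exact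
           | exact: reflector_adjoint].
    move=> M; rewrite is_zeroP; split=> [R0M|dM].
      have zR : is_zero (R0 M) by apply/is_zeroP.
      have bi := dist_first_zero_iso (D M) zR.
      by apply: (tsub_iso Hinf _ (QL M)); apply: isomorphic_sym; exists (b M).
    apply: (coreflection_inj (ca M) (PR M)).
    by rewrite compm0; exact: orth (PR M) _ dM _.
  move=> M; exists (a M), (b M), (c M); split=> [|A B f g h D' PA QB].
    exact: D.
  exact: (semiorthogonal_triangle_unique Ha orth (D M) (PR M) (QL M) D' PA QB).
split.
  move=> M W V j k l Wdec; split=> [i|].
    apply: (weight_decomposition_lift_unique (Wdec i.+1)).
    by case: (Wdec i).
  move=> phi hphi; split=> [|H]; first exact: hocolim_ex.
  exact: hocolimR Wdec hphi.
split.
  split=> [M|HCa]; first exact: almost_bounded_aboveE.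
  move=> I sI X AX; split=> [|S inj cS]; first exact: HCa.
  apply/almost_bounded_aboveE => //; apply: left_orth_coprod cS _ => i.
  exact: (orth _ (AX i)).
split.
  split=> // [M|].
    split=> [Mge|[A [B [f [g [h [D' /ambient_ge[_ Age] dB]]]]]]].
      exists (R0 M), (L0 M), (a M), (b M), (c M).
      split; [exact: D | apply/ambient_ge | exact: QL].
      by split; [exact: PR | exact: wgeR].
    by apply/wge0E; apply: (wge_ext D' _ (dB _)); apply/wge0E.
  split=> [|X Xle|X]; [exact: exR | | exact: wgeR].
  by apply: (wle0_iso (isomorphic_sym (isoR X (leA X Xle)))).
split.
  move=> M; rewrite ambient_ge; split=> [[PM Mge]|[Y [phi [Yb hH]]]]; last first.
    split; last by apply: hocolim_wge0 hH => // i; case: (Yb i).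
    by apply: hocolim_almost_bounded_above hH => i; case: (Yb i).
  have [W [V [j [k [l [phi [Wdec hphi]]]]]]] := weight_tower_ex w M.
  have [H hH] := hocolim_ex HC phi.
  have RH := hocolimR _ _ _ _ _ _ _ _ Wdec hphi hH.
  exists W, phi; split=> [i|].
    split; first by exists i%:Z; case: (Wdec i).
    (* [W i] is an extension of [M] by [V i] shifted back, of weights at least [i]. *)
    have [d _ Vge] := Wdec i; apply/wge0E; rewrite -wge_shift.
    apply: (wge_ext ((dist_rot _ _ _).1 ((dist_rot _ _ _).1 d))).
      by rewrite -PoszD addn1 in Vge; exact: (@wge_leq _ w 1 i.+1).
    by rewrite wge_shift; apply/wge0E.
  apply: hocolim_iso hH; apply: isomorphic_trans (isomorphic_sym RH) _.
  exact: (isoR M PM).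
split=> [smB I sI X S inj cS Y f|[HCa smge] I sI X dX].
  have cR := coreflect_coprod D ca cb smB sI cS.
  exact: (cR (sval Y) f).
split=> [|S inj cS l]; first exact: HCa.
by apply: (wge_coprod smge sI cS) => i; exact: dX.
Qed.
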